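(* Let $n\ge 2$, $\sigma>0$, $\mathbf f\in\mathbb R^n$, and let $\mathbf Y=\mathbf f+\sigma\boldsymbol\varepsilon$, where $\boldsymbol\varepsilon$ is a standard Gaussian vector in $\mathbb R^n$; write $\mathbb P_{\mathbf f,\sigma}$ for the law of $\mathbf Y$. Let $\alpha\in]0,1/2[$. Let $\mathbf v_1,\dots,\mathbf v_p\in\mathbb R^n$ be linearly independent, and set $$\mathcal C=\{\mathbf f\in\mathbb R^n:\ \langle \mathbf f,\mathbf v_j\rangle\le 0\ \text{for all } j=1,\dots,p\},\qquad \mathcal T=\Big\{\mathbf t=\sum_{j=1}^p\lambda_j\mathbf v_j:\ \|\mathbf t\|=1,\ \lambda_j\ge 0\ \forall j\Big\}.$$ Let $\mathcal T_n$ be a finite subset of $\mathcal T$, and let $V_n$ be a linear subspace of $\mathbb R^n$ of dimension $d_n<n$ containing the linear span of $\mathcal T_n$. Let $\{q_{\mathbf t}(\alpha),\ \mathbf t\in\mathcal T_n\}$ be real numbers satisfying $$\mathbb P\Big[\sup_{\mathbf t\in\mathcal T_n}\Big(\sqrt{n-d_n}\,\frac{\langle\boldsymbol\varepsilon,\mathbf t\rangle}{\|\boldsymbol\varepsilon-\Pi_{V_n}\boldsymbol\varepsilon\|}-q_{\mathbf t}(\alpha)\Big)>0\Big]=\alpha,$$ and define the test statistic $$T_\alpha=\sup_{\mathbf t\in\mathcal T_n}\Big(\sqrt{n-d_n}\,\frac{\langle\mathbf Y,\mathbf t\rangle}{\|\mathbf Y-\Pi_{V_n}\mathbf Y\|}-q_{\mathbf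 t}(\alpha)\Big).$$ Then $$\sup_{\sigma>0}\ \sup_{\mathbf f\in\mathcal C}\ \mathbb P_{\mathbf f,\sigma}(T_\alpha>0)=\mathbb P_{0,1}(T_\alpha>0)=\alpha.$$ Moreover, for every $\beta\in]0,1[$, $\mathbf f\in\mathbb R^n$ and $\sigma>0$, if there exists $\mathbf t\in\mathcal T_n$ such that $\langle\mathbf f,\mathbf t\rangle\ge v_{\mathbf t}(\mathbf f,\beta)$, where $$v_{\mathbf t}(\mathbf f,\beta)=\Big(q_{\mathbf t}(\alpha)\frac{1}{\sqrt{n-d_n}}\sqrt{\bar\chi^{-1}_{n-d_n,\|\mathbf f-\Pi_{V_n}\mathbf f\|^2/\sigma^2}(\beta/2)}+\bar\Phi^{-1}(\beta/2)\Big)\sigma,$$ then $\mathbb P_{\mathbf f,\sigma}(T_\alpha>0)\ge 1-\beta$.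
   Context: $\langle\cdot,\cdot\rangle$ and $\|\cdot\|$ are the Euclidean inner product and norm on $\mathbb R^n$; $\Pi_V$ is the orthogonal projection onto a linear subspace $V$. For $u\in[0,1]$, $\bar\Phi^{-1}(u)$ denotes the $1-u$ quantile of a standard Gaussian variable, and $\bar\chi^{-1}_{D,a^2}(u)$ the $1-u$ quantile of a noncentral $\chi^2$ variable with $D$ degrees of freedom and noncentrality parameter $a^2$. $\mathbb P_{0,1}$ is the law with $\mathbf f=0$, $\sigma=1$. *)

(* Defs.v *)
From HB Require Import structures.
From mathcomp Require Import all_boot all_order all_algebra.
From mathcomp Require Import all_classical all_reals all_analysis.
Set Implicit Arguments. Unset Strict Implicit. Unset Printing Implicit Defensive.
Import Order.TTheory GRing.Theory Num.Theory.
Local Open Scope classical_set_scope.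
Local Open Scope ring_scope.

Section defs.
Context {R : realType} {n : nat}.

Definition dotv (u v : 'rV[R]_n) : R := \sum_(i < n) u 0 i * v 0 i.
Definition enorm (u : 'rV[R]_n) : R := Num.sqrt (dotv u u).

Definition orth_proj (V : 'M[R]_n) (y : 'rV[R]_n) : 'rV[R]_n :=
  xget 0 [set p : 'rV[R]_n | (p <= V)%MS /\
        forall w : 'rV[R]_n, (w <= V)%MS -> dotv (y - p) w = 0].

Definition coneC p (v : 'I_p -> 'rV[R]_n) : set 'rV[R]_n :=
  [set f | forall j, dotv f (v j) <= 0].

Definition setT_dir p (v : 'I_p -> 'rV[R]_n) : set 'rV[R]_n :=
  [set t | enorm t = 1 /\ exists lam : 'I_p -> R,
       (forall j, 0 <= lam j) /\ t = \sum_(j < p) lam j *: v j].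

Definition Tstat (d : nat) (V : 'M[R]_n) (Tn : seq 'rV[R]_n) (q : 'rV[R]_n -> R)
    (y : 'rV[R]_n) : \bar R :=
  \big[Order.max/-oo%E]_(t <- Tn)
     ((Num.sqrt (n - d)%:R * dotv y t / enorm (y - orth_proj V y) - q t)%:E).

Context {dT : measure_display} {T : measurableType dT}.

Definition rvec (eps : 'I_n -> T -> R) (w : T) : 'rV[R]_n := \row_i eps i w.

Definition std_gaussian_vector (P : probability T R) (eps : 'I_n -> T -> R) :=
  (forall i, measurable_fun setT (eps i)) /\
  (forall i (A : set R), measurable A ->
      P (eps i @^-1` A) = normal_prob 0 1 A) /\
  (forall B : 'I_n -> set R, (forall i, measurable (B i)) ->
      P (\bigcap_(i in [set: 'I_n]) (eps i @^-1` B i)) =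
      (\prod_(i < n) P (eps i @^-1` B i))%E).

Definition upper_quantile (P : set T -> \bar R) (X : T -> R) (u : R) : R :=
  inf [set x : R | (P [set w | (x < X w)%R] <= u%:E)%E].

(* noncentral chi-square variable with D degrees of freedom and noncentrality a^2,
   built from the first D coordinates of eps: sum_{i<D} (eps_i + a [i = 0])^2 *)
Definition chi2nc_rv (eps : 'I_n -> T -> R) (D : nat) (a : R) (w : T) : R :=
  \sum_(i < n | (i < D)%N) (eps i w + (if val i == 0%N then a else 0)) ^+ 2.

End defs.

Definition gauss_upper_quantile {R : realType} (u : R) : R :=
  inf [set x : R | (normal_prob 0 1 `]x, +oo[ <= u%:E)%E].

(* Main.v *)
(** Rotate coordinates so that the orthogonal complement of [V] becomes the span
of the first [n - d] axes and the residual [f - Pi_V f] a nonnegative multiple of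
the first one.  The rotated noise is again standard Gaussian, the numerators
[<eps, t>] only involve the last [d] coordinates, and the squared residual norm is
[sigma^2] times a noncentral chi-square variable of the first [n - d] ones.

Since [alpha < 1/2] and [<eps, t>] is symmetric, every [q t] is positive.  For [f]
in the cone, rejection then forces [(x + a)^2 < K] where [x] is the first rotated
coordinate and [K] is a function of the others; as the centered interval is the
most likely of its length, this is at most as probable as [x^2 < K], which is the
rejection event under [f = 0].  The power bound is a union bound over the residual
exceeding its quantile and the numerator being atypically small.

Rotation invariance is reduced to plane rotations: the Lebesgue measure of the
plane is invariant under shears, a rotation is a product of three shears, and
Givens rotations bring any subspace into the required position. *)

Require Import Defs.
From HB Require Import structures.
From mathcomp Require Import all_boot all_order all_algebra.
From mathcomp Require Import all_classical all_reals all_analysis.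
From mathcomp Require Import measurable_realfun ring lra.
Set Implicit Arguments. Unset Strict Implicit. Unset Printing Implicit Defensive.
Import Order.TTheory GRing.Theory Num.Theory.
Local Open Scope classical_set_scope.
Local Open Scope ring_scope.

(** * Rotation invariance in the plane *)

Section lebesgue_invariance.
Context {R : realType}.
Local Notation mu := (@lebesgue_measure R).
Implicit Types f : R -> \bar R.

Lemma ge0_integral_oppr f : measurable_fun [set: R] f -> (forall x, 0 <= f x)%E ->
  (\int[mu]_x f (- x)%R = \int[mu]_x f x)%E.
Proof.
move=> mf f0.
have mN : measurable_fun setT (-%R : measurableTypeR R -> measurableTypeR R).
  exact: oppr_measurable.
have := @ge0_integral_pushforward _ _ _ _ R _ mN mu setT f
  measurableT mf (fun x _ => f0 x).
rewrite preimage_setT => <-.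
by apply: eq_measure_integral => A mA _; exact: lebesgue_measureN.
Qed.

(** The image of [mu] under the translation gives every half-open interval []x, y]] its length, and
    this property determines Lebesgue measure. *)
Lemma lebesgue_measure_shift (a : R) (A : set R) : measurable A ->
  mu ((fun x => x + a) @^-1` A) = mu A.
Proof.
move=> mA.
have mS : measurable_fun setT (fun x : measurableTypeR R => x + a : measurableTypeR R).
  exact: measurable_funD.
pose S : {mfun measurableTypeR R >-> measurableTypeR R} :=
  HB.pack (fun x : measurableTypeR R => x + a : measurableTypeR R)
    (isMeasurableFun.Build _ _ _ _ _ mS).
apply: esym; apply: (@lebesgue_measure_unique R (pushforward mu S)) => //.
move=> _ [[x y]] _ <-; rewrite /pushforward /=.
rewrite [X in _ = mu X](_ : _ = `]x - a, y - a]%classic).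
  rewrite !lebesgue_measure_itv/= !lte_fin ltrD2r -!EFinB.
  by congr (if _ then (_%:E) else _); lra.
by apply/seteqP; split => z /=; rewrite !in_itv/= ltrBlDr lerBrDr.
Qed.

Lemma ge0_integral_shift (a : R) f : measurable_fun [set: R] f ->
  (forall x, 0 <= f x)%E -> (\int[mu]_x f (x + a)%R = \int[mu]_x f x)%E.
Proof.
move=> mf f0.
have mS : measurable_fun setT (fun x : measurableTypeR R => x + a : measurableTypeR R).
  exact: measurable_funD.
have := @ge0_integral_pushforward _ _ _ _ R _ mS mu setT f
  measurableT mf (fun x _ => f0 x).
rewrite preimage_setT => <-.
by apply: eq_measure_integral => A mA _; exact: lebesgue_measure_shift.
Qed.

(** On each line of constant second coordinate the shear is a translation, so Tonelli with the first
    coordinate innermost reduces the claim to translation invariance. *)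
Lemma ge0_integral_shearl (a : R) (F : R * R -> \bar R) :
  measurable_fun [set: R * R] F -> (forall z, 0 <= F z)%E ->
  (\int[mu \x mu]_z F (z.1 + a * z.2, z.2)%R = \int[mu \x mu]_z F z)%E.
Proof.
move=> mF F0.
have mG : measurable_fun [set: R * R]
    (fun z : R * R => F (z.1 + a * z.2, z.2)%R).
  apply: measurableT_comp => //; apply: measurable_fun_pair => //=.
  by apply: measurable_funD => //; exact: measurable_funM.
rewrite [LHS]fubini_tonelli2// [RHS]fubini_tonelli2//.
apply: eq_integral => y _; rewrite /fubini_G.
rewrite -(@ge0_integral_shift (a * y) (fun x => F (x, y)))//.
exact: measurableT_comp.
Qed.

Lemma ge0_integral_shearr (a : R) (F : R * R -> \bar R) :
  measurable_fun [set: R * R] F -> (forall z, 0 <= F z)%E ->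
  (\int[mu \x mu]_z F (z.1, z.2 + a * z.1)%R = \int[mu \x mu]_z F z)%E.
Proof.
move=> mF F0.
have mG : measurable_fun [set: R * R]
    (fun z : R * R => F (z.1, z.2 + a * z.1)%R).
  apply: measurableT_comp => //; apply: measurable_fun_pair => //=.
  by apply: measurable_funD => //; exact: measurable_funM.
rewrite [LHS]fubini_tonelli1// [RHS]fubini_tonelli1//.
apply: eq_integral => x _; rewrite /fubini_F.
rewrite -(@ge0_integral_shift (a * x) (fun y => F (x, y)))//.
exact: measurableT_comp.
Qed.

(* A rotation of angle other than pi is a product of three shears. *)
Lemma ge0_integral_rot (c s : R) (F : R * R -> \bar R) :
  0 <= c -> c ^+ 2 + s ^+ 2 = 1 ->
  measurable_fun [set: R * R] F -> (forall z, 0 <= F z)%E ->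
  (\int[mu \x mu]_z F (c * z.1 + s * z.2, c * z.2 - s * z.1)%R =
   \int[mu \x mu]_z F z)%E.
Proof.
(* With [c] and [s] the cosine and sine of an angle, [t] is the tangent of half of it; [0 <= c]
   keeps the denominator away from zero. *)
move=> c0 cs mF F0; pose t := s / (1 + c).
have t1 : t * (1 + c) = s by rewrite /t mulfVK//; lra.
have t2 : t * s = 1 - c.
  rewrite /t mulrAC; have -> : s * s = (1 - c) * (1 + c) by move: cs; lra.
  by rewrite mulfK//; lra.
pose G (z : R * R) := F (z.1 + t * z.2, z.2).
pose H (z : R * R) := G (z.1, z.2 + - s * z.1).
have mG : measurable_fun setT G.
  apply: measurableT_comp => //; apply: measurable_fun_pair => //=.
  by apply: measurable_funD => //; exact: measurable_funM.
have mH : measurable_fun setT H.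
  apply: measurableT_comp => //; apply: measurable_fun_pair => //=.
  by apply: measurable_funD => //; exact: measurable_funM.
have G0 z : (0 <= G z)%E by exact: F0.
have H0 z : (0 <= H z)%E by exact: F0.
apply: etrans (ge0_integral_shearl t mF F0).
apply: etrans (ge0_integral_shearr (- s) mG G0).
apply: etrans (ge0_integral_shearl t mH H0).
apply: eq_integral => -[x y] _; rewrite /H /G /=.
(* The three shears compose to [(1 - t * s) * x + t * (2 - t * s) * y] and
   [(1 - t * s) * y - s * x]; multiples of [t1] and [t2] turn these into the rotation. *)
have e1 := congr1 (fun u => u * y) t1; have e2 := congr1 (fun u => u * x) t2.
have e3 := congr1 (fun u => u * y) t2; have e4 := congr1 (fun u => t * u * y) t2.
by congr (F (_, _)); lra.
Qed.

End lebesgue_invariance.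

(** * Symmetries of the Gaussian measure on the line and in the plane *)

Section gaussian_plane.
Context {R : realType}.
Local Notation mu := (@lebesgue_measure R).
Local Notation gamma := (normal_prob (0 : R) 1).
Local Notation phi := (normal_pdf (0 : R) 1).

Lemma normal_pdf01E x : phi x = normal_peak 1 * expR (- (x ^+ 2 / 2)).
Proof.
rewrite normal_pdfE// /normal_fun subr0; congr (_ * expR _).
by rewrite expr1n mulNr.
Qed.

Lemma normal_pdf01_anti x y : `|x| <= `|y| -> phi y <= phi x.
Proof.
move=> xy; rewrite !normal_pdf01E ler_wpM2l ?normal_peak_ge0// ler_expR lerN2.
rewrite ler_pM2r ?invr_gt0// -(real_normK (num_real x)).
by rewrite -(real_normK (num_real y)) lerXn2r// nnegrE.
Qed.

Lemma normal_pdf01N x : phi (- x) = phi x.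
Proof. by rewrite !normal_pdf01E sqrrN. Qed.

Let mphi : measurable_fun [set: R] (EFin \o phi).
Proof. by apply/measurable_EFinP; exact: measurable_normal_pdf. Qed.

Let phi0 x : (0 <= (phi x)%:E)%E.
Proof. by rewrite lee_fin normal_pdf_ge0. Qed.

Let phi2 (z : R * R) : \bar R := (phi z.1 * phi z.2)%:E.

Let mphi2 : measurable_fun setT phi2.
Proof.
apply/measurable_EFinP; apply: measurable_funM;
  by apply: measurableT_comp => //; exact: measurable_normal_pdf.
Qed.

Let phi2_ge0 z : (0 <= phi2 z)%E.
Proof. by rewrite lee_fin mulr_ge0 ?normal_pdf_ge0. Qed.

(** The planar Gaussian measure given by its density. It is made a measure in its own right so that
    uniqueness of product measures can identify it with [gamma \x gamma]. *)
Definition normal_plane (A : set (measurableTypeR R * measurableTypeR R)) : \bar R :=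
  (\int[mu \x mu]_(z in A) (phi z.1 * phi z.2)%:E)%E.

Let normal_plane0 : normal_plane set0 = 0%E.
Proof. by rewrite /normal_plane integral_set0. Qed.

Let normal_plane_ge0 A : (0 <= normal_plane A)%E.
Proof. by apply: integral_ge0 => z _; exact: phi2_ge0. Qed.

Let normal_plane_sigma_additive : semi_sigma_additive normal_plane.
Proof.
move=> /= A mA tA mUA.
rewrite /normal_plane/= ge0_integral_bigcup//=; last 2 first.
  by exact: (measurable_funTS mphi2).
  by move=> z _; exact: phi2_ge0.
apply: is_cvg_ereal_nneg_natsum_cond => n _ _.
by apply: integral_ge0 => z _; exact: phi2_ge0.
Qed.

HB.instance Definition _ := isMeasure.Build _ _ _
  normal_plane normal_plane0 normal_plane_ge0 normal_plane_sigma_additive.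

Let normal_plane_setX (B C : set R) : measurable B -> measurable C ->
  normal_plane (B `*` C) = (gamma B * gamma C)%E.
Proof.
move=> mB mC.
pose f (D : set R) x : R := (\1_D x * phi x).
have f0 D x : 0 <= f D x by rewrite mulr_ge0 ?normal_pdf_ge0.
have mf D : measurable D -> measurable_fun setT (f D).
  by move=> mD; apply: measurable_funM => //; exact: measurable_normal_pdf.
have gE (D : set R) : (gamma D = \int[mu]_x (f D x)%:E)%E.
  rewrite /normal_prob integral_mkcond.
  apply: (@eq_integral _ _ R mu) => x _.
  by rewrite patchE /f indicE; case: ifPn; rewrite ?mul1r ?mul0r.
transitivity (\int[mu \x mu]_z (f B z.1 * f C z.2)%:E)%E.
  rewrite /normal_plane integral_mkcond; apply: eq_integral => z _.
  rewrite patchE /f !indicE mulrACA -natrM mulnb -in_setX.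
  by case: ifPn; rewrite ?mul1r ?mul0r.
rewrite fubini_tonelli1//=; last 2 first.
- apply/measurable_EFinP; apply: measurable_funM;
    by apply: measurableT_comp => //; exact: mf.
- by move=> z; rewrite lee_fin mulr_ge0.
rewrite /fubini_F /=.
under eq_integral => x _.
  under eq_integral do rewrite EFinM.
  rewrite ge0_integralZl//; last 3 first.
  - by apply/measurable_EFinP; exact: mf.
  - by move=> y _; rewrite lee_fin.
  - by rewrite lee_fin.
  over.
rewrite ge0_integralZr//.
- by rewrite -!gE.
- by apply/measurable_EFinP; exact: mf.
- by move=> y _; rewrite lee_fin.
- by apply: integral_ge0 => y _; rewrite lee_fin.
Qed.

Lemma normal_prod_densityE (A : set (R * R)) : measurable A ->
  (gamma \x gamma)%E A = normal_plane A.
Proof.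
move=> mA.
refine (@product_measure_unique _ _ _ _ R gamma gamma normal_plane _ _ mA).
exact: normal_plane_setX.
Qed.

(** The planar density depends only on [x ^+ 2 + y ^+ 2], which the rotation preserves, and planar
    Lebesgue measure is rotation invariant. *)
Lemma normal_prod_rot (c s : R) (A : set (R * R)) :
  0 <= c -> c ^+ 2 + s ^+ 2 = 1 -> measurable A ->
  (gamma \x gamma)%E
    [set z | A (c * z.1 + s * z.2, c * z.2 - s * z.1)] = (gamma \x gamma)%E A.
Proof.
move=> c0 cs mA.
have mr : measurable_fun [set: R * R]
    (fun z : R * R => (c * z.1 + s * z.2, c * z.2 - s * z.1)).
  apply: measurable_fun_pair => /=; [apply: measurable_funD|
    apply: measurable_funB]; exact: measurable_funM.
have mB : measurable [set z : R * R | A (c * z.1 + s * z.2, c * z.2 - s * z.1)].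
  by rewrite -[X in measurable X]setTI; exact: mr.
rewrite !normal_prod_densityE// /normal_plane.
rewrite integral_mkcond [RHS]integral_mkcond.
pose F := phi2 \_ A.
have mF : measurable_fun setT F.
  by apply: (iffLR (measurable_restrictT _ mA)); exact: (measurable_funTS mphi2).
have F0 z : (0 <= F z)%E.
  by rewrite /F patchE; case: ifPn => // _; exact: phi2_ge0.
apply: etrans (ge0_integral_rot c0 cs mF F0).
apply: eq_integral => -[x y] _; rewrite /F !patchE /=.
rewrite -[(x, y) \in _]/((c * x + s * y, c * y - s * x) \in A).
case: ifPn => // _; rewrite /phi2 !normal_pdf01E; congr EFin.
rewrite mulrACA [RHS]mulrACA -!expRD; congr (_ * expR _).
have e1 := congr1 (fun u => u * x ^+ 2) cs.
have e2 := congr1 (fun u => u * y ^+ 2) cs.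
by rewrite /=; lra.
Qed.

Lemma normal_probN (A : set R) : measurable A -> gamma (-%R @^-1` A) = gamma A.
Proof.
move=> mA; rewrite /normal_prob integral_mkcond [RHS]integral_mkcond.
rewrite -[RHS]ge0_integral_oppr.
- apply: eq_integral => x _; rewrite !patchE -[x \in _]/(- x \in A).
  by rewrite normal_pdf01N.
- by apply: (iffLR (measurable_restrictT _ mA)); exact: (measurable_funTS mphi).
- by move=> z; rewrite patchE; case: ifPn => // _; exact: phi0.
Qed.

Lemma normal_prob_set1 (x : R) : gamma [set x] = 0%E.
Proof.
have /null_content_dominatesP := @normal_prob_dominates R 0 1; apply.
  exact: measurable_set1.
exact: lebesgue_measure_set1.
Qed.

(* The reflection [x |-> - a - x] exchanges the two intervals and moves the
   points of the centered one that it displaces away from the mode. *)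
Lemma normal_prob_shifted_itv (a w : R) :
  (gamma [set x : R | (`|x + a| < w)%R] <= gamma [set x : R | (`|x| < w)%R])%E.
Proof.
have mI b : measurable [set x : R | `|x + b| < w].
  rewrite (_ : [set _ | _] = `]- w - b, w - b[%classic)//.
  apply/seteqP; split => x /=; rewrite in_itv /= ltr_norml; lra.
pose I0 : set R := [set x | `|x| < w]; pose Ia : set R := [set x | `|x + a| < w].
have mI0 : measurable I0.
  by have := mI 0; under eq_set do rewrite addr0.
have mIa : measurable Ia by exact: mI.
have refl : gamma (Ia `\` I0) = (\int[mu]_(x in I0 `\` Ia) (phi (- a - x))%:E)%E.
  pose h := (fun x => (phi x)%:E) \_ (Ia `\` I0).
  have mh : measurable_fun setT h.
    apply: (iffLR (measurable_restrictT _ (measurableD mIa mI0))).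
    by exact: (measurable_funTS mphi).
  have h0 x : (0 <= h x)%E by rewrite /h patchE; case: ifPn => // _; exact: phi0.
  rewrite /normal_prob integral_mkcond -/h [RHS]integral_mkcond.
  (* The reflection is a sign change followed by a translation, and both preserve Lebesgue
     measure. *)
  apply: etrans (esym (ge0_integral_oppr mh h0)) _.
  have mhN : measurable_fun [set: R] (h \o -%R) by exact: measurableT_comp.
  apply: etrans (esym (ge0_integral_shift a mhN (fun x => h0 (- x)%R))) _.
  apply: (@eq_integral _ _ R mu) => x _; rewrite /h /= !patchE.
  rewrite (_ : (- (x + a) \in Ia `\` I0) = (x \in I0 `\` Ia)).
    by rewrite opprD [- x + _]addrC.
  by apply/idP/idP; rewrite !inE /Ia /I0 /= opprD subrK normrN -opprD normrN.
(* The two intervals share [Ia] intersected with [I0], so only the set differences have to be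
   compared. *)
rewrite -/I0 -/Ia [X in (gamma X <= _)%E](_ : _ = (Ia `\` I0) `|` (Ia `&` I0));
  last by rewrite setUC setUIDK.
rewrite [X in (_ <= gamma X)%E](_ : _ = (I0 `\` Ia) `|` (Ia `&` I0)); last first.
  by rewrite [Ia `&` I0]setIC setUC setUIDK.
have addU (A B : set R) : measurable A -> measurable B ->
    Ia `&` I0 `<=` B ->
    (gamma ((A `\` B) `|` (Ia `&` I0)) = gamma (A `\` B) + gamma (Ia `&` I0))%E.
  move=> mA mB sB; apply: (measureU (normal_prob 0 1));
    [exact: measurableD|exact: measurableI|].
  by apply/seteqP; split => [x [[_ nBx] /sB]|x []].
rewrite (addU Ia I0 mIa mI0 (@subIsetr _ _ _)).
rewrite (addU I0 Ia mI0 mIa (@subIsetl _ _ _)).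
have mr : measurable_fun [set: R] (fun x => (phi (- a - x))%:E).
  apply/measurable_EFinP; apply: (measurableT_comp (measurable_normal_pdf 0 1)).
  exact: measurable_funB.
apply: leeD2r; rewrite refl; apply: ge0_le_integral.
- exact: measurableD.
- by move=> x _; exact: phi0.
- exact: (measurable_funTS mr).
- exact: (measurable_funTS mphi).
move=> x [I0x Iax]; rewrite lee_fin; apply: normal_pdf01_anti.
(* A point of [I0] outside [Ia] satisfies [|x| < w <= |x + a|], so its reflection is farther from
   the mode. *)
rewrite -opprD normrN addrC; apply: ltW; apply: lt_le_trans I0x _.
by rewrite leNgt; apply/negP.
Qed.


End gaussian_plane.

(** * Law of a standard Gaussian vector *)

Section measurable_comparison.
Context d (T : measurableType d) (R : realType).
Implicit Types f g : T -> R.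

Lemma measurable_set_ltr f g : measurable_fun setT f -> measurable_fun setT g ->
  measurable [set w | f w < g w].
Proof.
move=> mf mg.
rewrite (_ : [set _ | _] = setT `&` (fun w => g w - f w) @^-1` `]0, +oo[).
  by apply: (measurable_funB mg mf) => //; exact: measurable_itv.
by apply/seteqP; split => w /=; rewrite in_itv/= andbT subr_gt0 => //; case.
Qed.

Lemma measurable_set_eqr f (c : R) : measurable_fun setT f ->
  measurable [set w | f w = c].
Proof.
move=> mf; have := mf measurableT [set c] (measurable_set1 c).
by rewrite setTI.
Qed.

End measurable_comparison.

Section measurable_coordinates.
Context d (T : measurableType d) (R : realType) (n : nat).
Variable X : 'I_n -> T -> R.
Hypothesis mX : forall i, measurable_fun setT (X i).

Lemma measurable_mktuple : measurable_fun setT (fun w => [tuple X i w | i < n]).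
Proof.
apply/measurable_fun_tnthP => i; rewrite (_ : _ \o _ = X i)//.
by apply/funext => w /=; rewrite tnth_mktuple.
Qed.

Lemma measurable_box (B : 'I_n -> set R) : (forall i, measurable (B i)) ->
  measurable [set w | forall i, B i (X i w)].
Proof.
move=> mB.
rewrite (_ : [set _ | _] = \bigcap_(i in [set: 'I_n]) (X i @^-1` B i)).
  apply: fin_bigcap_measurable => // i _.
  by rewrite -[Y in measurable Y]setTI; apply: mX.
by apply/seteqP; split => w /= h i => [_|]; exact: h.
Qed.

End measurable_coordinates.

Section gaussian_law.
Context {R : realType} {n : nat}.
Local Notation gamma := (normal_prob (0 : R) 1).

(* [m] is only a set function, so that this also applies to product measures. *)
Definition gaussian_boxes d (T : measurableType d) (m : set T -> \bar R)
    (eps : 'I_n -> T -> R) :=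
  (forall i, measurable_fun setT (eps i)) /\
  forall B : 'I_n -> set R, (forall i, measurable (B i)) ->
    m [set w | forall i, B i (eps i w)] = (\prod_(i < n) gamma (B i))%E.

(** Marginals and independence merge into one formula over boxes; conversely, a box with a single
    nontrivial side recovers a marginal. *)
Lemma std_gaussian_boxesP d (T : measurableType d) (P : probability T R)
    (eps : 'I_n -> T -> R) :
  std_gaussian_vector P eps <-> gaussian_boxes P eps.
Proof.
have capE (B : 'I_n -> set R) : \bigcap_(i in [set: 'I_n]) (eps i @^-1` B i) =
    [set w | forall i, B i (eps i w)].
  by apply/seteqP; split => w /= h i => [|_]; exact: h.
split=> [[meps [marg box]]|[meps box]].
  split=> // B mB; rewrite -capE box//; apply: eq_bigr => i _; exact: marg.
have marg i (A : set R) : measurable A -> P (eps i @^-1` A) = gamma A.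
  move=> mA; pose B j := if j == i then A else setT.
  have mB j : measurable (B j) by rewrite /B; case: ifP.
  have <- : [set w | forall j, B j (eps j w)] = eps i @^-1` A.
    apply/seteqP; split => w /=; first by move=> /(_ i); rewrite /B eqxx.
    by move=> Aw j; rewrite /B; case: ifP => // /eqP ->.
  rewrite box// (bigD1 i)//= {1}/B eqxx big1 ?mule1// => j /negPf ji.
  by rewrite /B ji; exact: (@probability_setT _ _ R (normal_prob 0 1)).
split=> //; split => // B mB; rewrite capE box//; apply: eq_bigr => i _.
by rewrite marg.
Qed.

Let boxes : set (set (n.-tuple R)) :=
  [set A | exists2 B : 'I_n -> set R, forall i, measurable (B i) &
     A = [set t | forall i, B i (tnth t i)]].

Let boxes_generate : @measurable _ (n.-tuple R) = <<s boxes >>.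
Proof.
apply/seteqP; split.
  apply: smallest_sub; first exact: smallest_sigma_algebra.
  apply: (big_ind (fun X => X `<=` <<s boxes >>)) => //.
    by move=> X Y hX hY t [/hX|/hY].
  move=> i _ _ [A mA <-]; apply: sub_sigma_algebra.
  exists (fun j => if j == i then A else setT) => [j|]; first by case: ifP.
  rewrite setTI; apply/seteqP; split => t /=.
    by move=> At j; case: ifP => // /eqP ->.
  by move=> /(_ i); rewrite eqxx.
apply: smallest_sub; first exact: sigma_algebra_measurable.
move=> _ [B mB ->].
apply: measurable_box => // i; exact: measurable_tnth.
Qed.

Section uniqueness.
Context d1 (T1 : measurableType d1) d2 (T2 : measurableType d2).
Variables (m1 : {measure set T1 -> \bar R}) (m2 : {measure set T2 -> \bar R}).
Variables (eps1 : 'I_n -> T1 -> R) (eps2 : 'I_n -> T2 -> R).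
Hypotheses (g1 : gaussian_boxes m1 eps1) (g2 : gaussian_boxes m2 eps2).

(** Boxes are stable under intersection, generate the sigma-algebra of tuples, and receive the same
    mass from both finite laws. The two underlying spaces may differ, which allows [eps] to be
    compared with copies on product spaces. *)
Lemma gaussian_law_unique (A : set (n.-tuple R)) : measurable A ->
  m1 [set w | A [tuple eps1 i w | i < n]] =
  m2 [set w | A [tuple eps2 i w | i < n]].
Proof.
pose f1 : {mfun T1 >-> n.-tuple R} := HB.pack (fun w => [tuple eps1 i w | i < n])
  (isMeasurableFun.Build _ _ _ _ _ (measurable_mktuple g1.1)).
pose f2 : {mfun T2 >-> n.-tuple R} := HB.pack (fun w => [tuple eps2 i w | i < n])
  (isMeasurableFun.Build _ _ _ _ _ (measurable_mktuple g2.1)).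
have boxT : boxes setT.
  by exists (fun=> setT) => //; apply/seteqP; split.
have boxE d (T : measurableType d) (eps : 'I_n -> T -> R) (B : 'I_n -> set R) :
    [set w | [set t | forall i, B i (tnth t i)] [tuple eps i w | i < n]] =
    [set w | forall i, B i (eps i w)].
  by apply/seteqP; split => w /= h i; have := h i; rewrite tnth_mktuple.
have p1 X : pushforward m1 f1 X = m1 [set w | X [tuple eps1 i w | i < n]].
  by [].
have p2 X : pushforward m2 f2 X = m2 [set w | X [tuple eps2 i w | i < n]].
  by [].
move=> mA; rewrite -p1 -p2.
apply: (measure_unique boxes (fun=> setT) boxes_generate _ _ _
  (pushforward m1 f1) (pushforward m2 f2)) => //.
- move=> _ _ [B mB ->] [C mC ->]; exists (fun i => B i `&` C i).
    by move=> i; exact: measurableI.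
  by apply/seteqP; split => t /= => [[h h'] i|h]; split => // i; case: (h i).
- by rewrite bigcup_const.
- move=> _ [B mB ->]; rewrite [LHS]p1 [RHS]p2 boxE boxE.
  by rewrite g1.2// g2.2.
- move=> _; rewrite [X in (X < _)%E]p1.
  have := g1.2 (fun=> setT) (fun=> measurableT).
  rewrite (_ : [set _ | _] = setT); last by apply/seteqP; split.
  rewrite big1; first by move=> ->; exact: ltry.
  by move=> i _; exact: (@probability_setT _ _ R (normal_prob 0 1)).
Qed.


End uniqueness.

End gaussian_law.

Section gaussian_vector.
Context {R : realType} {n : nat} {d : measure_display} {T : measurableType d}.
Variables (P : probability T R) (eps : 'I_n -> T -> R).
Hypothesis geps : gaussian_boxes P eps.
Local Notation gamma := (normal_prob (0 : R) 1).

(** Realizes the same law with coordinate [i0] as a separate factor, so that this coordinate alone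
    can be integrated with the others held fixed. *)
Lemma gaussian_boxes_replace1 (i0 : 'I_n) :
  gaussian_boxes (P \x gamma)%E
    (fun i (z : T * measurableTypeR R) => if i == i0 then z.2 else eps i z.1).
Proof.
split=> [i|B mB].
  case: (i == i0); first exact: measurable_snd.
  by apply: measurableT_comp; [exact: geps.1|exact: measurable_fst].
pose B' i := if i == i0 then setT else B i.
have mB' i : measurable (B' i) by rewrite /B'; case: ifP.
rewrite (_ : [set _ | _] = [set w | forall i, B' i (eps i w)] `*` B i0).
  transitivity (P [set w | forall i, B' i (eps i w)] * gamma (B i0))%E.
    exact: (@product_measure1E _ _ T (measurableTypeR R) R P gamma _ _
      (measurable_box geps.1 mB') (mB i0)).
  rewrite geps.2// muleC [in RHS](bigD1 i0)//=; congr (_ * _)%E.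
  rewrite (bigD1 i0)//= {1}/B' eqxx (@probability_setT _ _ R gamma) mul1e.
  by apply: eq_bigr => i /negPf ii0; rewrite /B' ii0.
apply/seteqP; split => -[w x] /=.
  move=> h; split=> [i|]; last by have := h i0; rewrite eqxx.
  by rewrite /B'; case: ifP => // ii0; have := h i; rewrite ii0.
move=> [h hx] i; case: eqP => [->//|/eqP/negPf ii0].
by have := h i; rewrite /B' ii0.
Qed.

(** With the other coordinates fixed, [K] is a constant and the claim compares two intervals of
    half-width [Num.sqrt K]; integrating this one-dimensional comparison over the other coordinates
    gives the result. *)
Lemma gaussian_shifted_square_le (i0 : 'I_n) (K : n.-tuple R -> R) (a : R) :
  measurable_fun setT K ->
  (forall t t', (forall j, j != i0 -> tnth t j = tnth t' j) -> K t = K t') ->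
  (P [set w | ((eps i0 w + a) ^+ 2 < K [tuple eps i w | i < n])%R] <=
   P [set w | ((eps i0 w) ^+ 2 < K [tuple eps i w | i < n])%R])%E.
Proof.
move=> mK Kext.
pose eta i (z : T * measurableTypeR R) := if i == i0 then z.2 else eps i z.1.
pose A b : set (n.-tuple R) := [set t | (tnth t i0 + b) ^+ 2 < K t].
have mA b : measurable (A b).
  apply: measurable_set_ltr => //; apply: measurable_funX.
  by apply: measurable_funD => //; exact: measurable_tnth.
pose E b : set (T * measurableTypeR R) := [set z | A b [tuple eta i z | i < n]].
have PE b : P [set w | A b [tuple eps i w | i < n]] = (P \x gamma)%E (E b).
  apply: gaussian_law_unique => //; exact: gaussian_boxes_replace1.
have mE b : measurable (E b).
  rewrite -[X in measurable X]setTI; apply: measurable_mktuple => // i.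
  exact: (gaussian_boxes_replace1 i0).1.
have KE w x : K [tuple eta i (w, x) | i < n] = K [tuple eps i w | i < n].
  by apply: Kext => j /negPf ji; rewrite !tnth_mktuple /eta ji.
(* For [k <= 0] both sides are false, since [Num.sqrt k] is then 0. *)
have sqE (u k : R) : (u ^+ 2 < k) = (`|u| < Num.sqrt k).
  rewrite -sqrtr_sqr; have [k0|k0] := ltP 0 k; first by rewrite ltr_sqrt.
  rewrite (ler0_sqrtr k0) ltNge (le_trans k0 (sqr_ge0 u)).
  by rewrite ltNge sqrtr_ge0.
have xE b w : xsection (E b) w =
    [set x | `|x + b| < Num.sqrt (K [tuple eps i w | i < n])].
  apply/seteqP; split => x; rewrite /xsection /= in_setE /E /A /= KE;
    by rewrite tnth_mktuple /eta eqxx sqE.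
have -> : [set w | (eps i0 w + a) ^+ 2 < K [tuple eps i w | i < n]] =
    [set w | A a [tuple eps i w | i < n]].
  by apply/seteqP; split => w; rewrite /A/= tnth_mktuple.
have -> : [set w | (eps i0 w) ^+ 2 < K [tuple eps i w | i < n]] =
    [set w | A 0 [tuple eps i w | i < n]].
  by apply/seteqP; split => w; rewrite /A/= tnth_mktuple addr0.
rewrite !PE /product_measure1; apply: ge0_le_integral.
- exact: measurableT.
- by move=> w _; exact: (measure_ge0 (normal_prob 0 1)).
- exact: measurable_fun_xsection.
- exact: measurable_fun_xsection.
move=> w _ /=; rewrite !xE.
under [X in (_ <= gamma X)%E]eq_set do rewrite addr0.
exact: normal_prob_shifted_itv.
Qed.

End gaussian_vector.

(** * Rotations of Gaussian vectors *)

Section rotations.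
Context {R : realType} {n : nat}.
Local Notation gamma := (normal_prob (0 : R) 1).

Definition givens (i j : 'I_n) (c s : R) (u : 'rV[R]_n) : 'rV[R]_n :=
  \row_k (if k == i then c * u 0 i + s * u 0 j
          else if k == j then c * u 0 j - s * u 0 i else u 0 k).

Definition flip (i : 'I_n) (u : 'rV[R]_n) : 'rV[R]_n :=
  \row_k (if k == i then - u 0 i else u 0 k).

Context {d : measure_display} {T : measurableType d}.
Variables (P : probability T R).
Implicit Types eps : 'I_n -> T -> R.

(** Puts coordinates [i] and [j] into a planar factor of their own, the only factor on which a
    rotation of these two coordinates acts. *)
Lemma gaussian_boxes_replace2 eps (i j : 'I_n) : i != j ->
  gaussian_boxes P eps ->
  gaussian_boxes ((gamma \x gamma) \x P)%E
    (fun k (z : measurableTypeR R * measurableTypeR R * T) =>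
       if k == i then z.1.1 else if k == j then z.1.2 else eps k z.2).
Proof.
move=> ij geps; split=> [k|B mB].
  case: (k == i).
    by apply: (measurableT_comp measurable_fst); exact: measurable_fst.
  case: (k == j).
    by apply: (measurableT_comp measurable_snd); exact: measurable_fst.
  by apply: (measurableT_comp (geps.1 k)); exact: measurable_snd.
pose B' k := if (k == i) || (k == j) then setT else B k.
have mB' k : measurable (B' k) by rewrite /B'; case: ifP.
rewrite (_ : [set _ | _] =
    (B i `*` B j) `*` [set w | forall k, B' k (eps k w)]).
  transitivity ((gamma \x gamma)%E (B i `*` B j) *
      P [set w | forall k, B' k (eps k w)])%E.
    exact: (@product_measure1E _ _ (measurableTypeR R * measurableTypeR R)%type
      T R (gamma \x gamma)%E P _ _ (measurableX (mB i) (mB j))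
      (measurable_box geps.1 mB')).
  rewrite (_ : (gamma \x gamma)%E (B i `*` B j) = (gamma (B i) * gamma (B j))%E).
    rewrite geps.2// (bigD1 i)//= (bigD1 j) 1?eq_sym//=.
    rewrite [in RHS](bigD1 i)//= [in RHS](bigD1 j) 1?eq_sym//=.
    rewrite {1 2}/B' !eqxx orbT /= (@probability_setT _ _ R gamma) !mul1e.
    rewrite muleA; congr (_ * _)%E; apply: eq_bigr => k /andP[/negPf ki /negPf kj].
    by rewrite /B' ki kj.
  exact: (@product_measure1E _ _ (measurableTypeR R) (measurableTypeR R) R
    gamma gamma _ _ (mB i) (mB j)).
apply/seteqP; split => -[[x y] w] /=.
  move=> h; split; first split.
  - by have := h i; rewrite eqxx.
  - by have := h j; rewrite eqxx eq_sym (negPf ij).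
  by move=> k; rewrite /B'; have := h k; case: eqP => //= _; case: eqP.
move=> [[hx hy] h] k; case: eqP => [->//|/eqP/negPf ki].
case: eqP => [->//|/eqP/negPf kj].
by have := h k; rewrite /B' ki kj.
Qed.

(** By uniqueness of the law, [eps] may be replaced by the resampled [eta]. For [eta] the event
    becomes a rotated rectangle times an event on the other coordinates, and the planar Gaussian
    measure ignores the rotation. *)
Lemma gaussian_boxes_givens eps (i j : 'I_n) (c s : R) : i != j -> 0 <= c ->
  c ^+ 2 + s ^+ 2 = 1 -> gaussian_boxes P eps ->
  gaussian_boxes P (fun k w => givens i j c s (rvec eps w) 0 k).
Proof.
move=> ij c0 cs geps.
have mg d' (T' : measurableType d') (X : 'I_n -> T' -> R) k :
    (forall k, measurable_fun setT (X k)) ->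
    measurable_fun setT (fun w => givens i j c s (rvec X w) 0 k).
  move=> mX; rewrite /givens /rvec.
  under eq_fun do rewrite !mxE.
  case: (k == i); first by apply: measurable_funD; exact: measurable_funM.
  case: (k == j); first by apply: measurable_funB; exact: measurable_funM.
  exact: mX.
split=> [k|B mB]; first by apply: mg; exact: geps.1.
pose Q := ((gamma \x gamma) \x P)%E.
pose eta k (z : measurableTypeR R * measurableTypeR R * T) :=
  if k == i then z.1.1 else if k == j then z.1.2 else eps k z.2.
have geta : gaussian_boxes Q eta by exact: gaussian_boxes_replace2.
pose A : set (n.-tuple R) :=
  [set t | forall k, B k (givens i j c s (\row_l tnth t l) 0 k)].
have mA : measurable A.
  apply: (@measurable_box _ (n.-tuple R) R n
    (fun k t => givens i j c s (\row_l tnth t l) 0 k)) => // k.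
  apply: (mg _ _ (fun l (t : n.-tuple R) => tnth t l)) => l.
  exact: measurable_tnth.
have AE d' (T' : measurableType d') (X : 'I_n -> T' -> R) :
    [set w | forall k, B k (givens i j c s (rvec X w) 0 k)] =
    [set w | A [tuple X l w | l < n]].
  apply/seteqP; split => w /= h k; have := h k;
    rewrite (_ : rvec X w = \row_l tnth [tuple X l0 w | l0 < n] l)//;
    by apply/rowP => l; rewrite !mxE tnth_mktuple.
rewrite AE (gaussian_law_unique geps geta mA) -AE -(geta.2 B mB).
pose B' k := if (k == i) || (k == j) then setT else B k.
have mB' k : measurable (B' k) by rewrite /B'; case: ifP.
pose C := [set w | forall k, B' k (eps k w)].
have mC : measurable C := measurable_box geps.1 mB'.
pose rot := [set z : R * R | (B i `*` B j) (c * z.1 + s * z.2, c * z.2 - s * z.1)].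
have mrot : measurable rot.
  rewrite -[X in measurable X]setTI.
  have mr : measurable_fun [set: R * R]
      (fun z : R * R => (c * z.1 + s * z.2, c * z.2 - s * z.1)).
    apply: measurable_fun_pair => /=; [apply: measurable_funD|
      apply: measurable_funB]; exact: measurable_funM.
  by apply: mr => //; exact: measurableX.
have e1 : [set w | forall k, B k (givens i j c s (rvec eta w) 0 k)] = rot `*` C.
  apply/seteqP; split => -[[x y] w] /=.
    move=> h; split; first split => /=.
    - by have := h i; rewrite !mxE /eta eqxx eq_sym (negPf ij) eqxx.
    - by have := h j; rewrite !mxE /eta !eqxx eq_sym (negPf ij).
    move=> k; rewrite /B'; have := h k; rewrite !mxE.
    by rewrite /eta; case: (k == i) => //=; case: (k == j).
  move=> [[/= h1 h2] h] k; rewrite !mxE /eta.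
  case: eqP => [->|/eqP/negPf ki]; first by rewrite eqxx eq_sym (negPf ij) eqxx.
  case: eqP => [->|/eqP/negPf kj]; first by rewrite eqxx eq_sym (negPf ij) eqxx.
  by have := h k; rewrite /B' ki kj.
have e2 : [set w | forall k, B k (eta k w)] = (B i `*` B j) `*` C.
  apply/seteqP; split => -[[x y] w] /=.
    move=> h; split; first split => /=.
    - by have := h i; rewrite /eta eqxx.
    - by have := h j; rewrite /eta eqxx eq_sym (negPf ij).
    move=> k; rewrite /B'; have := h k.
    by rewrite /eta; case: (k == i) => //=; case: (k == j).
  move=> [[/= h1 h2] h] k; rewrite /eta.
  case: eqP => [->//|/eqP/negPf ki].
  case: eqP => [->//|/eqP/negPf kj].
  by have := h k; rewrite /B' ki kj.
have QE (E : set (R * R)) : measurable E ->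
    Q (E `*` C) = ((gamma \x gamma)%E E * P C)%E.
  move=> mE.
  exact: (@product_measure1E _ _ (measurableTypeR R * measurableTypeR R)%type
      T R (gamma \x gamma)%E P _ _ mE mC).
apply: etrans (congr1 _ e1) _; apply: etrans _ (esym (congr1 _ e2)).
apply: etrans (QE _ mrot) _.
apply: etrans _ (esym (QE _ (measurableX (mB i) (mB j)))).
by rewrite (normal_prod_rot c0 cs)//; exact: measurableX.
Qed.

Lemma gaussian_boxes_flip eps (i : 'I_n) : gaussian_boxes P eps ->
  gaussian_boxes P (fun k w => flip i (rvec eps w) 0 k).
Proof.
move=> geps; split=> [k|B mB].
  rewrite /flip /rvec; under eq_fun do rewrite !mxE.
  have mi := geps.1 i.
  by case: (k == i); [exact: measurableT_comp|exact: geps.1].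
pose B' k := if k == i then -%R @^-1` B k else B k.
have mB' k : measurable (B' k).
  rewrite /B'; case: ifP => // _.
  by rewrite -[X in measurable X]setTI; exact: (oppr_measurable measurableT).
rewrite (_ : [set _ | _] = [set w | forall k, B' k (eps k w)]).
  rewrite geps.2//; apply: eq_bigr => k _; rewrite /B'; case: ifP => // _.
  exact: normal_probN.
by apply/seteqP; split => w /= h k; have := h k; rewrite /B' !mxE;
  case: eqP => // ->.
Qed.

End rotations.

(** * The Euclidean inner product *)

Section dot_product.
Context {R : realType} {n : nat}.
Implicit Types u v w : 'rV[R]_n.

Lemma dotvC u v : dotv u v = dotv v u.
Proof. by apply: eq_bigr => i _; rewrite mulrC. Qed.

Lemma dotv_linl a u v w : dotv (a *: u + v) w = a * dotv u w + dotv v w.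
Proof.
rewrite /dotv big_distrr -big_split; apply: eq_bigr => i _ /=.
by rewrite !mxE mulrDl mulrA.
Qed.

Lemma dotvDl u v w : dotv (u + v) w = dotv u w + dotv v w.
Proof. by rewrite -[u]scale1r dotv_linl scale1r mul1r. Qed.

Lemma dotvZl a u w : dotv (a *: u) w = a * dotv u w.
Proof.
by rewrite -[a *: u]addr0 dotv_linl [X in _ + X]big1 ?addr0// => i _;
  rewrite mxE mul0r.
Qed.

Lemma dotv_delta u i : dotv u (delta_mx 0 i) = u 0 i.
Proof.
rewrite /dotv (bigD1 i)//= big1 ?addr0; first by rewrite mxE !eqxx mulr1.
by move=> j /negPf ji; rewrite mxE ji mulr0.
Qed.

Lemma dotv_ge0 u : 0 <= dotv u u.
Proof. by apply: sumr_ge0 => i _; rewrite -expr2 sqr_ge0. Qed.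

Lemma dotv_eq0 u : dotv u u = 0 -> u = 0.
Proof.
move=> /psumr_eq0P h; apply/rowP => i; rewrite mxE.
have /h : forall i : 'I_n, true -> 0 <= u 0 i * u 0 i.
  by move=> j _; rewrite -expr2 sqr_ge0.
by move=> /(_ i isT)/eqP; rewrite mulf_eq0 orbb => /eqP.
Qed.

Lemma dotv_mulmx u v : dotv u v = (u *m v^T) 0 0.
Proof. by rewrite mxE; apply: eq_bigr => i _; rewrite mxE. Qed.

Lemma dotvE_enorm u : dotv u u = enorm u ^+ 2.
Proof. by rewrite sqr_sqrtr// dotv_ge0. Qed.

End dot_product.

(** * Linear isometries that preserve the Gaussian law *)

Section gaussian_isometry.
Context {R : realType} {n : nat} {d : measure_display} {T : measurableType d}.
Variable P : probability T R.
Implicit Types (F G : 'rV[R]_n -> 'rV[R]_n) (u v : 'rV[R]_n).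

(** Invariance of the law is carried as a field and propagated by composition from plane rotations
    and sign changes, so no general orthogonal matrix has to be decomposed. Quantifying over all
    Gaussian [eps] is what makes the class closed under composition. *)
Record gaussian_isometry F : Prop := GaussianIsometry {
  giso_lin : forall a u v, F (a *: u + v) = a *: F u + F v;
  giso_dot : forall u v, dotv (F u) (F v) = dotv u v;
  giso_law : forall eps : 'I_n -> T -> R, gaussian_boxes P eps ->
    gaussian_boxes P (fun k w => F (rvec eps w) 0 k) }.

Lemma giso_id : gaussian_isometry id.
Proof.
split=> // eps; rewrite (_ : (fun k w => _) = eps)//.
by apply/funext => k; apply/funext => w; rewrite mxE.
Qed.

Lemma giso_comp F G : gaussian_isometry F -> gaussian_isometry G ->
  gaussian_isometry (G \o F).
Proof.
move=> [lF dF gF] [lG dG gG]; split=> [a u v|u v|eps /gF/gG] /=.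
- by rewrite lF lG.
- by rewrite dG dF.
rewrite (_ : (fun k w => _) = (fun k w => G (F (rvec eps w)) 0 k))//.
apply/funext => k; apply/funext => w; congr (G _ 0 k).
by apply/rowP => l; rewrite mxE.
Qed.

Lemma giso_givens (i j : 'I_n) (c s : R) : i != j -> 0 <= c ->
  c ^+ 2 + s ^+ 2 = 1 -> gaussian_isometry (givens i j c s).
Proof.
move=> ij c0 cs; split; last by move=> eps; exact: gaussian_boxes_givens.
- move=> a u v; apply/rowP => k; rewrite !mxE.
  by case: eqP => _; [|case: eqP => _]; ring.
move=> u v; rewrite /dotv (bigD1 i)//= (bigD1 j) 1?eq_sym//=.
rewrite [RHS](bigD1 i)//= [X in _ = _ + X](bigD1 j) 1?eq_sym//=.
rewrite !mxE !eqxx [j == i]eq_sym (negPf ij) !addrA; congr (_ + _).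
  have -> : u 0 i * v 0 i + u 0 j * v 0 j =
    (c ^+ 2 + s ^+ 2) * (u 0 i * v 0 i + u 0 j * v 0 j) by rewrite cs mul1r.
  by ring.
by apply: eq_bigr => k /andP[/negPf ki /negPf kj]; rewrite !mxE ki kj.
Qed.

Lemma giso_flip (i : 'I_n) : gaussian_isometry (flip i).
Proof.
split; last by move=> eps; exact: gaussian_boxes_flip.
- by move=> a u v; apply/rowP => k; rewrite !mxE; case: eqP => _ //; ring.
move=> u v; apply: eq_bigr => k _; rewrite !mxE.
by case: eqP => // ->; rewrite mulrNN.
Qed.

Section theory.
Variable F : 'rV[R]_n -> 'rV[R]_n.
Hypothesis gF : gaussian_isometry F.

Lemma gisoD u v : F (u + v) = F u + F v.
Proof. by rewrite -{1}[u]scale1r (giso_lin gF) scale1r. Qed.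

Lemma giso0 : F 0 = 0.
Proof.
by have /eqP := gisoD 0 0; rewrite addr0 -subr_eq0 opprD addNKr oppr_eq0 => /eqP.
Qed.

Lemma gisoZ a u : F (a *: u) = a *: F u.
Proof. by rewrite -{1}[a *: u]addr0 (giso_lin gF) giso0 addr0. Qed.

Lemma gisoB u v : F (u - v) = F u - F v.
Proof. by rewrite addrC -scaleN1r (giso_lin gF) scaleN1r addrC. Qed.

Lemma giso_sum (I : finType) (Q : pred I) (f : I -> 'rV[R]_n) :
  F (\sum_(i | Q i) f i) = \sum_(i | Q i) F (f i).
Proof. by rewrite (big_morph F gisoD giso0). Qed.

Lemma giso_inj : injective F.
Proof.
move=> u v uv; apply/eqP; rewrite -subr_eq0; apply/eqP/dotv_eq0.
by rewrite -(giso_dot gF) gisoB uv subrr /dotv big1// => i _; rewrite mxE mul0r.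
Qed.

Definition giso_mx : 'M[R]_n := \matrix_i F (delta_mx 0 i).

Lemma gisoE u : F u = u *m giso_mx.
Proof.
rewrite mulmx_sum_row {1}[u]row_sum_delta giso_sum.
by apply: eq_bigr => i _; rewrite gisoZ rowK.
Qed.

Lemma giso_mx_free : row_free giso_mx.
Proof.
rewrite -kermx_eq0; apply/eqP/row_matrixP => i; rewrite row0.
by apply: giso_inj; rewrite giso0 gisoE; apply/sub_kermxP; exact: row_sub.
Qed.

End theory.

(** Rotations in the planes of axes [k] and [l], for successive [l] beyond [k], clear coordinate
    [l], and a flip of axis [k] fixes the sign. All of these act only on coordinates from [k] on, so
    vectors supported before [k] do not move. *)
Lemma giso_align u (k : 'I_n) : exists2 F, gaussian_isometry F &
  [/\ forall v, (forall j : 'I_n, (k <= j)%N -> v 0 j = 0) -> F v = v,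
      forall j : 'I_n, (k < j)%N -> F u 0 j = 0 & 0 <= F u 0 k].
Proof.
suff [F gF [Ffix Fu]] : exists2 F, gaussian_isometry F &
    (forall v, (forall j : 'I_n, (k <= j)%N -> v 0 j = 0) -> F v = v) /\
    (forall j : 'I_n, (k < j)%N -> F u 0 j = 0).
  have [Fk|Fk] := leP 0 (F u 0 k); first by exists F.
  exists (flip k \o F); first exact: giso_comp (giso_flip k).
  split=> [v v0|j kj|] /=.
  - rewrite Ffix//; apply/rowP => j; rewrite mxE; case: eqP => // ->.
    by rewrite v0// oppr0.
  - by rewrite mxE; case: eqP => [jk|_]; [rewrite jk ltnn in kj|exact: Fu].
  - by rewrite mxE eqxx oppr_ge0 ltW.
suff H m : exists2 F, gaussian_isometry F &
    (forall v, (forall j : 'I_n, (k <= j)%N -> v 0 j = 0) -> F v = v) /\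
    (forall j : 'I_n, (k < j < m)%N -> F u 0 j = 0).
  have [F gF [Ffix Fu]] := H n; exists F => //; split=> // j kj.
  by apply: Fu; rewrite kj ltn_ord.
elim: m => [|m [F gF [Ffix Fu]]].
  by exists id; [exact: giso_id|split=> // j; rewrite ltn0 andbF].
have [mn|nm] := ltnP m n; last first.
  exists F => //; split=> // j /andP[kj jm]; apply: Fu.
  by rewrite kj (leq_trans (ltn_ord j)).
pose l := Ordinal mn.
have [kl|lk] := ltnP k m; last first.
  exists F => //; split=> // j /andP[kj jm].
  by have := leq_trans kj jm; rewrite ltnNge lk.
pose a := F u 0 k; pose b := F u 0 l.
have [b0|b0] := eqVneq b 0.
  exists F => //; split=> // j /andP[kj]; rewrite ltnS leq_eqVlt => /orP[/eqP jm|jm].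
    by rewrite (_ : j = l)//; exact: val_inj.
  by apply: Fu; rewrite kj.
have ab0 : 0 < a ^+ 2 + b ^+ 2.
  by rewrite ltr_wpDl ?sqr_ge0// lt_neqAle eq_sym sqrf_eq0 b0 sqr_ge0.
pose r := Num.sqrt (a ^+ 2 + b ^+ 2).
have r0 : 0 < r by rewrite sqrtr_gt0.
have rr : r ^+ 2 = a ^+ 2 + b ^+ 2 by rewrite sqr_sqrtr// ltW.
(* The sign makes the cosine [c] nonnegative, as invariance under [givens] requires. Coordinate [k]
   becomes [sg * r], whose sign is left to the flip above. *)
pose sg : R := if a < 0 then -1 else 1.
have sg2 : sg ^+ 2 = 1 by rewrite /sg; case: ifP; rewrite ?sqrrN expr1n.
have asg : 0 <= sg * a.
  by rewrite /sg; case: ltP => a0; rewrite ?mul1r// mulN1r oppr_ge0 ltW.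
pose c := sg * a / r; pose s := sg * b / r.
have kl' : k != l by apply/eqP => /(congr1 val)/= e; rewrite e ltnn in kl.
have cs : c ^+ 2 + s ^+ 2 = 1.
  rewrite /c /s !exprMn sg2 !mul1r -mulrDl -rr -exprMn divff ?expr1n//.
  exact: lt0r_neq0.
have c0 : 0 <= c by rewrite divr_ge0// ltW.
exists (givens k l c s \o F); first exact: giso_comp (giso_givens kl' c0 cs).
split=> [v v0|j /andP[kj jm]] /=.
  rewrite Ffix//; apply/rowP => j; rewrite mxE (v0 k)// (v0 l) ?(ltnW kl)//.
  by rewrite !mulr0 addr0 subr0; case: eqP => [->|_]; [rewrite v0|case: eqP => [->|//];
    rewrite v0// ltnW].
rewrite mxE; have -> : (j == k) = false by apply/eqP => jk; rewrite jk ltnn in kj.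
case: eqP => [_|jl]; first by rewrite -/a -/b /c /s; field; exact: lt0r_neq0.
apply: Fu; rewrite kj /= ltn_neqAle -ltnS jm andbT.
by apply/eqP => jm'; apply: jl; exact: val_inj.
Qed.

End gaussian_isometry.

(** * A frame adapted to a subspace and a vector in it *)

Section adapted_frame.
Context {R : realType} {n : nat} {d : measure_display} {T : measurableType d}.
Variable P : probability T R.
Implicit Types (F G : 'rV[R]_n -> 'rV[R]_n) (u v : 'rV[R]_n).

(** Invariant of the construction of the frame. Extending at [k] fixes only vectors supported on the
    first [k] axes, so [F g] must already be supported there; the clause for [k = 0] ensures this in
    the initial case. *)
Let frame (W : 'M[R]_n) (g : 'rV[R]_n) (k : nat) F :=
  [/\ gaussian_isometry P F, forall j : 'I_n, (0 < j)%N -> F g 0 j = 0,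
      forall j : 'I_n, val j = 0%N -> 0 <= F g 0 j, k = 0%N -> F g = 0 &
      forall j : 'I_n, (j < k)%N ->
        exists2 w, (w <= W)%MS & F w = delta_mx 0 j].

(** The part of [F u] beyond the first [k] axes is rotated onto axis [k]. Subtracting from [u] a
    vector of [W] that accounts for the first [k] coordinates, and rescaling, yields a preimage of
    the new axis in [W]. *)
Let frame_extend W g k F u : frame W g k F -> (u <= W)%MS ->
  (exists2 j : 'I_n, (k <= j)%N & F u 0 j != 0) ->
  exists G, frame W g k.+1 G.
Proof.
move=> [gF Fg Fg0 Fk0 FW] uW [j kj Fuj].
have kn : (k < n)%N := leq_ltn_trans kj (ltn_ord j).
pose l := Ordinal kn.
have [G gG [Gfix Gu Gk]] := giso_align P (F u) l.
have gGF := giso_comp gF gG.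
have GFg : G (F g) = F g.
  apply: Gfix => i /= ki; case: (posnP k) => [k0|k0]; first by rewrite Fk0// mxE.
  by apply: Fg; exact: leq_trans ki.
have Gdelta (i : 'I_n) : (i < k)%N -> G (delta_mx 0 i) = delta_mx 0 i.
  move=> ik; apply: Gfix => i' /= ki'; rewrite mxE /=.
  by case: eqP => // e; have := leq_trans ik ki'; rewrite e ltnn.
pose c := G (F u) 0 l.
(* If [c = 0] then [G] fixes [G (F u)], hence fixes [F u] by injectivity. *)
have c0 : c != 0.
  apply: contra Fuj => /eqP c0.
  have e : G (F u) = F u.
    apply: (giso_inj gG); apply: Gfix => i /=; rewrite leq_eqVlt => /orP[/eqP ki|].
      by rewrite (_ : i = l) //; exact: val_inj.
    exact: Gu.
  move: kj; rewrite leq_eqVlt -e => /orP[/eqP kj|kj]; last by rewrite Gu.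
  by rewrite (_ : j = l); [exact/eqP|exact: val_inj].
have SP (f : 'I_n -> R) : exists2 w, (w <= W)%MS &
    G (F w) = \sum_(i < n | (i < k)%N) f i *: delta_mx 0 i.
  apply: (big_ind (fun x => exists2 w, (w <= W)%MS & G (F w) = x)).
  - by exists 0; [exact: sub0mx|rewrite (giso0 gF) (giso0 gG)].
  - move=> x y [w wW <-] [w' w'W <-]; exists (w + w'); first exact: addmx_sub.
    by rewrite (gisoD gF) (gisoD gG).
  - move=> i ik; have [w wW Fw] := FW i ik; exists (f i *: w).
      exact: scalemx_sub.
    by rewrite (gisoZ gF) (gisoZ gG) Fw Gdelta.
exists (G \o F); split=> //=.
- by move=> i i0; rewrite GFg Fg.
- by move=> i i0; rewrite GFg Fg0.
move=> i; rewrite ltnS leq_eqVlt => /orP[/eqP ik|ik]; last first.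
  by have [w wW Fw] := FW i ik; exists w; rewrite // Fw Gdelta.
have -> : i = l by exact: val_inj.
have [w wW Gw] := SP (fun i => G (F u) 0 i).
exists (c^-1 *: (u - w)).
  by apply: scalemx_sub; apply: addmx_sub => //; rewrite eqmx_opp.
rewrite (gisoZ gF) (gisoZ gG) (gisoB gF) (gisoB gG) Gw.
apply: (scalerI c0); rewrite scalerA divff// scale1r.
rewrite {1}[G (F u)]row_sum_delta (bigID (fun i : 'I_n => (i < k)%N))/=.
rewrite addrC addrK (bigD1 l) /= ?ltnn// big1 ?addr0// => i' /andP[].
rewrite -leqNgt => ki' il; rewrite Gu ?scale0r//= ltn_neqAle ki' andbT.
by apply: contra il => /eqP ki; apply/eqP/val_inj.
Qed.

(** An orthonormalization of [W] performed by rotating the ambient space: axes are added until the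
    image of [W] lies in the span of the first [k]. A vector orthogonal to [W] is then orthogonal to
    the preimages of these axes. *)
Lemma giso_adapted (W : 'M[R]_n) (g : 'rV[R]_n) : (0 < n)%N -> (g <= W)%MS ->
  exists2 F, gaussian_isometry P F &
  [/\ forall j : 'I_n, (0 < j)%N -> F g 0 j = 0,
      forall j : 'I_n, val j = 0%N -> 0 <= F g 0 j,
      forall u, (u <= W)%MS -> forall j : 'I_n, (\rank W <= j)%N -> F u 0 j = 0 &
      forall u, (forall w, (w <= W)%MS -> dotv u w = 0) ->
        forall j : 'I_n, (j < \rank W)%N -> F u 0 j = 0].
Proof.
move=> n0 gW.
suff [k [F [kn [gF Fg Fg0 Fk0 FW] Fz]]] : exists k F, [/\ (k <= n)%N, frame W g k F &
    forall u, (u <= W)%MS -> forall j : 'I_n, (k <= j)%N -> F u 0 j = 0].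
  (* The image of [W] is exactly the span of the first [k] axes, which is the row space of
     [pid_mx k], and [F] preserves rank. *)
  have kW : k = \rank W.
    rewrite -(mxrankMfree W (giso_mx_free gF)) -(@rank_pid_mx R n n k)//.
    apply/eqP; rewrite eqn_leq; apply/andP; split; apply: mxrankS.
      apply/row_subP => i; have [ik|ki] := ltnP i k.
        have [w wW Fw] := FW i ik.
        rewrite (_ : row i _ = w *m giso_mx F); first exact: submxMr.
        rewrite -(gisoE gF) Fw; apply/rowP => j; rewrite !mxE eqxx /=.
        by rewrite ik andbT eq_sym.
      rewrite (_ : row i _ = 0) ?sub0mx//; apply/rowP => j; rewrite !mxE.
      by rewrite ltnNge ki andbF.
    apply/row_subP => i; rewrite row_mul -(gisoE gF).
    rewrite (_ : F _ = F (row i W) *m pid_mx k); first exact: submxMl.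
    apply/rowP => j; rewrite mxE (bigD1 j)//= big1 ?addr0 => [|i' /negPf ij].
      rewrite mxE eqxx /=; have [jk|kj] := ltnP j k; first by rewrite mulr1.
      by rewrite mulr0 Fz// row_sub.
    by rewrite mxE (_ : (val i' == val j) = false)// mulr0.
  exists F => //; split=> //; first by rewrite -kW.
  move=> u uW j; rewrite -kW => jk; have [w wW Fw] := FW j jk.
  by rewrite -dotv_delta -Fw (giso_dot gF) uW.
(* If the image of [g] vanishes the construction starts at [k = 0]; otherwise a multiple of [g]
   itself is the preimage of the first axis and it starts at [k = 1]. *)
have [F0 F0fr] : exists F, exists2 k, (k <= n)%N & frame W g k F.
  have [F gF [_ Fg Fg0]] := giso_align P g (Ordinal n0).
  have Fg0' (j : 'I_n) : val j = 0%N -> 0 <= F g 0 j.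
    by move=> j0; rewrite (_ : j = Ordinal n0)//; exact: val_inj.
  have [z|z] := eqVneq (F g 0 (Ordinal n0)) 0.
    exists F, 0%N => //; split=> // _; apply/rowP => j; rewrite mxE.
    have [j0|j0] := posnP j; last exact: Fg.
    by rewrite (_ : j = Ordinal n0)//; exact: val_inj.
  exists F, 1%N => //; split=> // j; rewrite ltnS leqn0 => /eqP j0.
  exists ((F g 0 (Ordinal n0))^-1 *: g); first exact: scalemx_sub.
  have -> : j = Ordinal n0 by exact: val_inj.
  rewrite (gisoZ gF); apply: (scalerI z); rewrite scalerA divff// scale1r.
  rewrite [LHS]row_sum_delta (bigD1 (Ordinal n0))//= big1 ?addr0// => i i0.
  rewrite Fg ?scale0r// lt0n; apply: contra i0 => /eqP i0.
  by apply/eqP/val_inj.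
have [k0 k0n {}F0fr] := F0fr.
(* Induction on the number [n - k] of axes left; at [k = n] no coordinate remains outside the
   frame. *)
elim: {k0}(n - k0)%N {-2}k0 (erefl (n - k0)%N) k0n F0 F0fr => [|m IH] k nk kn F FF.
  exists k, F; split=> // u uW j kj.
  by have := leq_ltn_trans kj (ltn_ord j); rewrite -subn_gt0 nk.
have [h|/forallNP h] := pselect (exists u, (u <= W)%MS /\
    exists2 j : 'I_n, (k <= j)%N & F u 0 j != 0).
  have [u [uW hu]] := h; have [G fG] := frame_extend FF uW hu.
  by apply: (IH k.+1 _ _ G fG); rewrite ?subnS ?nk// -subn_gt0 nk.
exists k, F; split=> // u uW j kj; apply/eqP/negP => /negP hj.
by apply: (h u); split=> //; exists j.
Qed.

End adapted_frame.

(** * Existence of orthogonal projections *)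

Section orthogonal_projection.
Context {R : realType} {n : nat}.
Implicit Types (u v w y : 'rV[R]_n) (V : 'M[R]_n).

Lemma sub_kermx_tr V u : (u <= kermx V^T)%MS <->
  forall w, (w <= V)%MS -> dotv u w = 0.
Proof.
split=> [/sub_kermxP uV w /submxP[D ->]|h].
  by rewrite dotv_mulmx trmx_mul mulmxA uV mul0mx mxE.
apply/sub_kermxP/rowP => i.
rewrite [RHS]mxE -(h (row i V) (row_sub i V)) [LHS]mxE.
by apply: eq_bigr => j _; rewrite !mxE.
Qed.

(** It suffices that some point qualifies, since [xget] then returns such a point. One exists
    because [V] and [kermx V^T], its orthogonal complement, meet only in 0 and have ranks adding up
    to [n]. *)
Lemma orth_projP V y : (orth_proj V y <= V)%MS /\
  forall w, (w <= V)%MS -> dotv (y - orth_proj V y) w = 0.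
Proof.
rewrite /orth_proj; set A := [set p | _].
suff : exists p, A p by move=> [p Ap]; have := xgetPex 0 (ex_intro A p Ap).
have VW0 : (V :&: kermx V^T)%MS = 0.
  apply/eqP; rewrite -submx0; apply/row_subP => i.
  have := row_sub i (V :&: kermx V^T)%MS; rewrite sub_capmx => /andP[rV].
  by move=> /sub_kermx_tr/(_ _ rV)/dotv_eq0 ->; exact: sub0mx.
have full : row_full (V + kermx V^T)%MS.
  rewrite /row_full mxrank_disjoint_sum// mxrank_ker mxrank_tr.
  by rewrite subnKC// rank_leq_row.
have /sub_addsmxP[[a b] /= yE] := submx_full y full.
exists (a *m V); split; first exact: submxMl.
move=> w wV; rewrite {1}yE addrC addKr.
by apply: (iffLR (sub_kermx_tr V _)) => //; exact: submxMl.
Qed.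

End orthogonal_projection.

(** * Quantiles and tails *)

Section quantile.
Context {R : realType} {d : measure_display} {T : measurableType d}.
Variable P : probability T R.

Lemma measure_bigcup_le (F : (set T)^nat) (u : \bar R) :
  (forall k, measurable (F k)) -> nondecreasing_seq F ->
  (forall k, P (F k) <= u)%E -> (P (\bigcup_k F k) <= u)%E.
Proof.
move=> mF ndF Fu.
have h := @nondecreasing_cvg_mu _ _ _ P F mF (bigcup_measurable (fun k _ => mF k)) ndF.
have <- := cvg_lim (@ereal_hausdorff R) h.
apply: lime_le; first by apply/cvg_ex; exists (P (\bigcup_k F k)).
exact: nearW.
Qed.

(** The tail function is right-continuous, so the infimum belongs to the set. The bounds [0 < u] and
    [u < 1] make the set nonempty and bounded below, so that [inf] is a genuine infimum. *)
Lemma upper_quantile_le (X : T -> R) (u : R) : measurable_fun setT X ->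
  0 < u < 1 -> (P [set w | (upper_quantile P X u < X w)%R] <= u%:E)%E.
Proof.
move=> mX /andP[u0 u1]; set q := upper_quantile P X u.
have mS x : measurable [set w | x < X w].
  by apply: measurable_set_ltr => //; exact: measurable_cst.
pose A := [set x : R | (P [set w | (x < X w)%R] <= u%:E)%E].
have anti x y : x <= y -> (P [set w | (y < X w)%R] <= P [set w | (x < X w)%R])%E.
  by move=> xy; apply: le_measure; rewrite ?inE// => w /=; exact: le_lt_trans.
have A0 : A !=set0.
  apply: contrapT => /forallNP A0.
  have : (P (\bigcup_k ~` [set w | (k%:R < X w)%R]) <= (1 - u)%:E)%E.
    apply: measure_bigcup_le => [k|k l kl|k].
    - exact: measurableC.
    - apply/subsetPset => w /= /negP; rewrite -leNgt => h; apply/negP.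
      by rewrite -leNgt (le_trans h)// ler_nat.
    rewrite probability_setC// EFinB; apply: leeB => //.
    by have := A0 k%:R; rewrite /A/= => /negP; rewrite -ltNge => /ltW.
  rewrite (_ : \bigcup_k _ = setT) ?probability_setT.
    by rewrite lee_fin => h; move: u0 h; lra.
  apply/seteqP; split=> // w _.
  exists (Num.truncn (X w)).+1 => //=; apply/negP; rewrite -leNgt ltW//.
  exact: truncnS_gt.
have [k Ak] : exists k : nat, (u%:E < P [set w | (- k%:R < X w)%R])%E.
  apply: contrapT => /forallNP h.
  have : (P (\bigcup_k [set w | (- k%:R < X w)%R]) <= u%:E)%E.
    apply: measure_bigcup_le => [k|k l kl|k]; first exact: mS.
    - apply/subsetPset => w /=; apply: le_lt_trans.
      by rewrite lerN2 ler_nat.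
    by have /negP := h k; rewrite -leNgt.
  rewrite (_ : \bigcup_k _ = setT) ?probability_setT.
    by rewrite lee_fin => h'; move: u1 h'; lra.
  apply/seteqP; split=> // w _; exists (Num.truncn (- X w)).+1 => //=.
  by rewrite ltrNl truncnS_gt.
have lbA : has_lbound A.
  exists (- k%:R) => x Ax; rewrite leNgt; apply/negP => /ltW/anti h.
  by have := lt_le_trans Ak (le_trans h Ax); rewrite ltxx.
(* Right-continuity at [q]: the tails at [q + j.+1%:R^-1] increase to the tail at [q], and each
   threshold lies above a member of [A]. *)
rewrite (_ : [set w | _] = \bigcup_j [set w | (q + j.+1%:R^-1 < X w)%R]).
  apply: measure_bigcup_le => [j|j l jl|j]; first exact: mS.
    apply/subsetPset => w /=; apply: le_lt_trans.
    by rewrite lerD2l lef_pV2 ?posrE// ler_nat.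
  have j0 : (0 : R) < j.+1%:R^-1 by rewrite invr_gt0.
  have [x Ax xq] := inf_adherent j0 (conj A0 lbA).
  by apply: le_trans Ax; apply: anti; rewrite ltW.
apply/seteqP; split=> w /=.
  move=> qX; exists (Num.bound ((X w - q)^-1)) => //=.
  rewrite -ltrBrDl -[ltRHS]invrK ltf_pV2 ?posrE ?invr_gt0 ?subr_gt0//.
  rewrite (lt_trans (archi_boundP _))// ?invr_ge0 ?subr_ge0 ?(ltW qX)//.
  by rewrite ltr_nat.
by move=> [j _ /=]; apply: lt_trans; rewrite ltrDl invr_gt0.
Qed.

End quantile.

Section normal_tails.
Context {R : realType}.
Local Notation gamma := (normal_prob (0 : R) 1).

(** The two open half-lines have equal mass by symmetry and, together with the null set of the
    origin, cover the line. *)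
Lemma normal_prob_gt0_half : ((2^-1)%:E <= gamma [set x : R | (0 < x)%R])%E.
Proof.
have mp : measurable [set x : R | (0 < x)%R].
  by apply: measurable_set_ltr => //; exact: measurable_cst.
pose N := -%R @^-1` [set x : R | (0 < x)%R].
have mN : measurable N.
  by rewrite -[X in measurable X]setTI; exact: oppr_measurable.
have h : (1 <= gamma [set x : R | (0 < x)%R] + gamma [set x : R | (0 < x)%R])%E.
  rewrite -{2}(normal_probN mp) -/N -(@probability_setT _ _ R gamma).
  apply: (@le_trans _ _ (gamma ([set x : R | (0 < x)%R] `|` (N `|` [set 0%R])))).
    apply: (@le_measure _ _ _ gamma); rewrite ?inE//.
      by apply: measurableU => //; exact: measurableU.
    move=> x _ /=; rewrite /N /= oppr_gt0; have [|x0|->] := ltgtP x 0.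
    - by right; left.
    - by left.
    - by right; right.
  apply: le_trans (@measureU2 _ _ _ gamma _ _ mp _) _; first exact: measurableU.
  apply: leeD2l; apply: le_trans (@measureU2 _ _ _ gamma _ _ mN _) _.
    exact: measurable_set1.
  by rewrite [X in (_ + X)%E](normal_prob_set1 (0 : R)) adde0.
move: h; have : gamma [set x : R | (0 < x)%R] \is a fin_num.
  exact: (@fin_num_measure _ _ _ gamma).
case: (gamma _) => // r _; rewrite -EFinD !lee_fin; lra.
Qed.

(** Reflection produces the closed right tail at the quantile, which exceeds the open one only by a
    null point. *)
Lemma normal_prob_le_opp_quantile (u : R) : 0 < u < 1 ->
  (gamma [set x : R | (x <= - gauss_upper_quantile u)%R] <= u%:E)%E.
Proof.
move=> u01; set z := gauss_upper_quantile u.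
have zE : z = upper_quantile (gamma : probability _ R) (id : measurableTypeR R -> R) u.
  rewrite /z /gauss_upper_quantile /upper_quantile; congr inf.
  by apply/seteqP; split=> x /=; rewrite set_itvoy.
have mp : measurable [set x : R | (z < x)%R].
  by apply: measurable_set_ltr => //; exact: measurable_cst.
have <- : -%R @^-1` ([set x : R | (z < x)%R] `|` [set z]) =
    [set x : R | (x <= - z)%R].
  apply/seteqP; split => x /=; rewrite lerNr le_eqVlt.
    by case=> [->|->]; rewrite ?orbT ?eqxx.
  by move=> /orP[/eqP ->|]; [right|left].
rewrite normal_probN; last by apply: measurableU.
rewrite (@measureU0 _ _ _ gamma)//; last exact: normal_prob_set1.
by rewrite zE; apply: (@upper_quantile_le R _ _ gamma).
Qed.

End normal_tails.

(** * The test *)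

Section residual.
Context {R : realType} {n : nat} {d : measure_display} {T : measurableType d}.
Variable P : probability T R.
Local Notation gamma := (normal_prob (0 : R) 1).

(** An isometry preserving the Gaussian law carries the unit vector [t] to the first axis, where the
    inner product is a single coordinate. *)
Lemma gaussian_dotv (eps : 'I_n -> T -> R) (t : 'rV[R]_n) (A : set R) :
  (0 < n)%N -> gaussian_boxes P eps -> enorm t = 1 -> measurable A ->
  P [set w | A (dotv (rvec eps w) t)] = gamma A.
Proof.
move=> n0 geps t1 mA; pose k := Ordinal n0.
have [F gF [_ Ft Ft0]] := giso_align P t k.
have sqFt : F t 0 k ^+ 2 = 1.
  have := dotvE_enorm t; rewrite t1 expr1n -(giso_dot gF) /dotv (bigD1 k)//=.
  rewrite big1 ?addr0 -?expr2// => j jk; rewrite Ft ?mul0r// lt0n.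
  by apply: contra jk => /eqP jk; apply/eqP/val_inj.
have Ft1 : F t = delta_mx 0 k.
  have e : F t 0 k = 1.
    by apply/eqP; rewrite -(@eqrXn2 _ 2)// expr1n sqFt.
  rewrite [F t]row_sum_delta (bigD1 k)//= e scale1r big1 ?addr0// => j jk.
  rewrite Ft ?scale0r// lt0n.
  by apply: contra jk => /eqP jk; apply/eqP/val_inj.
have [_ [marg _]] := iffRL (std_gaussian_boxesP P _) (giso_law gF geps).
rewrite -(marg k A mA); congr (P _); apply/seteqP; split => w /=;
  by rewrite -(giso_dot gF) Ft1 dotv_delta.
Qed.

(** The adapted frame of the orthogonal complement of [V] and the residual of [f]. Vectors of [V]
    vanish on the leading axes, so there [F y] agrees with the image of its residual. *)
Lemma residual_frame (V : 'M[R]_n) (f : 'rV[R]_n) : (\rank V < n)%N ->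
  exists2 F, gaussian_isometry P F &
  [/\ forall t, (t <= V)%MS ->
        forall j : 'I_n, (j < n - \rank V)%N -> F t 0 j = 0,
      forall y, enorm (y - orth_proj V y) =
        Num.sqrt (\sum_(i < n | (i < n - \rank V)%N) F y 0 i ^+ 2) &
      forall j : 'I_n, (j < n - \rank V)%N ->
        F f 0 j = if val j == 0%N then enorm (f - orth_proj V f) else 0].
Proof.
move=> Vn; pose W := kermx V^T; pose g := f - orth_proj V f.
have res y : (y - orth_proj V y <= W)%MS.
  by apply/sub_kermx_tr; exact: (orth_projP V y).2.
have rW : \rank W = (n - \rank V)%N by rewrite mxrank_ker mxrank_tr.
have [F gF] := giso_adapted P (leq_ltn_trans (leq0n _) Vn) (res f).
rewrite rW -/g => -[Fg Fg0 FW FV].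
have FV0 t : (t <= V)%MS -> forall j : 'I_n, (j < n - \rank V)%N -> F t 0 j = 0.
  move=> tV j jV; apply: FV => // w /sub_kermx_tr wW.
  by rewrite dotvC wW.
have Fres y (j : 'I_n) : (j < n - \rank V)%N ->
    F (y - orth_proj V y) 0 j = F y 0 j.
  move=> jV; rewrite (gisoB gF) !mxE [X in _ - X]FV0 ?subr0//.
  exact: (orth_projP V y).1.
have sumE y : enorm (y - orth_proj V y) =
    Num.sqrt (\sum_(i < n | (i < n - \rank V)%N) F y 0 i ^+ 2).
  rewrite /enorm -(giso_dot gF) /dotv.
  rewrite (bigID (fun i : 'I_n => (i < n - \rank V)%N))/= [X in _ + X]big1.
    by rewrite addr0; congr Num.sqrt; apply: eq_bigr => i iV;
      rewrite Fres// expr2.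
  by move=> i; rewrite -leqNgt => iV; rewrite FW ?mul0r.
exists F => //; split=> // j jV; rewrite -(Fres f)// -/g.
case: (posnP j) => j0; last by rewrite Fg.
rewrite sumE (bigD1 j)//= big1 ?addr0.
  by rewrite sqrtr_sqr -(Fres f)// ger0_norm// Fg0.
move=> i /andP[iV ij]; rewrite -(Fres f)// Fg ?expr0n// lt0n.
by apply: contra ij => /eqP i0; apply/eqP/val_inj; rewrite /= i0 j0.
Qed.

End residual.

(** * The rejection event and its measurability *)

Lemma Tstat_gt0P (R : realType) (n d : nat) (V : 'M[R]_n) (Tn : seq 'rV[R]_n)
    (q : 'rV[R]_n -> R) (y : 'rV[R]_n) : (0 < Tstat d V Tn q y)%E <->
  exists2 t, t \in Tn &
    q t < Num.sqrt (n - d)%:R * dotv y t / enorm (y - orth_proj V y).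
Proof.
rewrite /Tstat; elim: Tn => [|t s IH].
  by rewrite big_nil; split => // -[].
rewrite big_cons lt_max lte_fin subr_gt0; split.
  move=> /orP[qt|/(iffLR IH)[u us qu]]; first by exists t; rewrite ?mem_head.
  by exists u; rewrite // in_cons us orbT.
move=> [u]; rewrite in_cons => /orP[/eqP -> ->//|us qu].
by apply/orP; right; apply/(iffRL IH); exists u.
Qed.

Lemma measurable_set_ltr_div d (T : measurableType d) (R : realType)
    (c : R) (f g : T -> R) : measurable_fun setT f -> measurable_fun setT g ->
  (forall w, 0 <= g w) -> measurable [set w | c < f w / g w].
Proof.
move=> mf mg g0.
(* [x / 0 = 0] *)
rewrite (_ : [set _ | _] = [set w | 0 < g w] `&` [set w | c * g w < f w] `|`
    ([set w | g w = 0] `&` [set w : T | c < 0])).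
  apply: measurableU; apply: measurableI.
  - by apply: measurable_set_ltr => //; exact: measurable_cst.
  - by apply: measurable_set_ltr => //; apply: measurable_funM => //; exact: measurable_cst.
  - exact: measurable_set_eqr.
  - by apply: measurable_set_ltr; exact: measurable_cst.
apply/seteqP; split => w /=.
  have := g0 w; rewrite le_eqVlt => /orP[/eqP <-|gw]; last first.
    by rewrite ltr_pdivlMr// => h; left.
  by rewrite invr0 mulr0 => h; right.
by move=> [[gw h]|[-> h]]; [rewrite ltr_pdivlMr|rewrite invr0 mulr0].
Qed.

Lemma measurable_sqrt (d : measure_display) (T : measurableType d) (R : realType)
    (f : T -> R) : measurable_fun setT f ->
  measurable_fun setT (fun w => Num.sqrt (f w)).
Proof.
move=> mf; apply: (measurableT_comp _ mf).
by apply: continuous_measurable_fun; exact: sqrt_continuous.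
Qed.

Section test_event.
Context {R : realType} {n : nat} {dT : measure_display} {T : measurableType dT}.
Variables (P : probability T R) (eps : 'I_n -> T -> R).
Variables (Tn : seq 'rV[R]_n) (V : 'M[R]_n) (q : 'rV[R]_n -> R).
Hypotheses (geps : gaussian_boxes P eps) (Vn : (\rank V < n)%N).

Lemma measurable_dotv_rvec (X : 'I_n -> T -> R) (t : 'rV[R]_n) :
  (forall i, measurable_fun setT (X i)) ->
  measurable_fun setT (fun w => dotv (rvec X w) t).
Proof.
move=> mX; apply: measurable_sum => i; apply: measurable_funM => //.
by under eq_fun do rewrite mxE; exact: mX.
Qed.

Lemma measurable_residual (f : 'rV[R]_n) (sigma : R) :
  measurable_fun setT (fun w => enorm (f + sigma *: rvec eps w -
    orth_proj V (f + sigma *: rvec eps w))).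
Proof.
have [F gF [_ FE _]] := residual_frame P f Vn.
under eq_fun do rewrite FE.
apply: measurable_sqrt; under eq_fun do rewrite big_mkcond.
apply: measurable_sum => i; case: (i < _)%N; last exact: measurable_cst.
apply: measurable_funX; under eq_fun do rewrite addrC (giso_lin gF) !mxE.
apply: measurable_funD; last exact: measurable_cst.
by apply: measurable_funM; [exact: measurable_cst|exact: (giso_law gF geps).1].
Qed.

Lemma measurable_Tstat_gt0 (f : 'rV[R]_n) (sigma : R) (d : nat) :
  measurable [set w | (0 < Tstat d V Tn q (f + sigma *: rvec eps w))%E].
Proof.
rewrite (_ : [set _ | _] = \bigcup_(t in [set` Tn]) [set w |
    q t < Num.sqrt (n - d)%:R * dotv (f + sigma *: rvec eps w) t /
    enorm (f + sigma *: rvec eps w - orth_proj V (f + sigma *: rvec eps w))]).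
  apply: fin_bigcup_measurable => // t _; apply: measurable_set_ltr_div.
  - apply: measurable_funM; first exact: measurable_cst.
    under eq_fun do rewrite addrC dotv_linl.
    apply: measurable_funD; last exact: measurable_cst.
    apply: measurable_funM; first exact: measurable_cst.
    by apply: measurable_dotv_rvec; exact: geps.1.
  - exact: measurable_residual.
  - by move=> w; exact: sqrtr_ge0.
apply/seteqP; split => w /=.
  by move=> /Tstat_gt0P[t tT h]; exists t.
by move=> [t tT h]; apply/Tstat_gt0P; exists t.
Qed.

End test_event.

Lemma lt_bigmax_ge0 (R : realType) (I : eqType) (s : seq I) (f : I -> R) (x : R) :
  0 <= x -> x < \big[Num.max/0]_(i <- s) f i -> exists2 i, i \in s & x < f i.
Proof.
move=> x0; elim: s => [|i s IH]; first by rewrite big_nil ltNge x0.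
rewrite big_cons lt_max => /orP[xi|/IH[j js xj]].
  by exists i; rewrite ?mem_head.
by exists j; rewrite // in_cons js orbT.
Qed.

Lemma gaussian_coord_null (R : realType) n (d : measure_display)
    (T : measurableType d) (P : probability T R) (eps : 'I_n -> T -> R) i c :
  gaussian_boxes P eps -> P [set w | eps i w = c] = 0%E.
Proof.
move=> /(iffRL (std_gaussian_boxesP P _)) [_ [marg _]].
by have := marg i [set c] (measurable_set1 c); rewrite normal_prob_set1.
Qed.

(** * Level and power of the test *)

Section test_level_power.
Context {R : realType} {n : nat} {dT : measure_display} {T : measurableType dT}.
Variables (P : probability T R) (eps : 'I_n -> T -> R).
Variables (Tn : seq 'rV[R]_n) (V : 'M[R]_n) (q : 'rV[R]_n -> R).
Hypotheses (geps : gaussian_boxes P eps) (Vn : (\rank V < n)%N).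
Hypothesis TnV : forall t, t \in Tn -> (t <= V)%MS.
Local Notation m := (n - \rank V)%N.
Local Notation sqm := (Num.sqrt (m%:R : R)).
Local Notation event f sigma :=
  [set w | (0 < Tstat (\rank V) V Tn q (f + sigma *: rvec eps w))%E].
Local Notation resid y := (enorm (y - orth_proj V y)).

Let n_gt0 : (0 < n)%N. Proof. exact: leq_ltn_trans Vn. Qed.
Let i0 : 'I_n := Ordinal n_gt0.
Let i0m : (i0 < m)%N. Proof. by rewrite /= subn_gt0. Qed.
Let sqm_gt0 : 0 < sqm. Proof. by rewrite sqrtr_gt0 ltr0n subn_gt0. Qed.

Let chi2nc_split (X : 'I_n -> T -> R) a w : chi2nc_rv X m a w =
  (X i0 w + a) ^+ 2 + \sum_(i < n | (i < m)%N && (i != i0)) X i w ^+ 2.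
Proof.
rewrite /chi2nc_rv (bigD1 i0)//=; congr (_ + _); apply: eq_bigr => i /andP[_ ii0].
case: eqP => [i_0|_]; last by rewrite addr0.
by case/eqP: ii0; exact: val_inj.
Qed.

(** Confines a vanishing residual to the event [X i0 w = - a], null for Gaussian [X], so that
    division by zero does not affect probabilities. *)
Let chi2nc_gt0 (X : 'I_n -> T -> R) a w : X i0 w != - a -> 0 < chi2nc_rv X m a w.
Proof.
move=> h; rewrite chi2nc_split ltr_pwDl//; last first.
  by apply: sumr_ge0 => i _; exact: sqr_ge0.
by rewrite lt_neqAle sqr_ge0 eq_sym sqrf_eq0 addr_eq0 h.
Qed.

Section frame.
Variables (f : 'rV[R]_n) (F : 'rV[R]_n -> 'rV[R]_n).
Hypothesis gF : gaussian_isometry P F.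
Hypothesis FE : forall y, resid y =
  Num.sqrt (\sum_(i < n | (i < m)%N) F y 0 i ^+ 2).
Hypothesis Ff : forall j : 'I_n, (j < m)%N ->
  F f 0 j = if val j == 0%N then resid f else 0.
Let eta (i : 'I_n) w := F (rvec eps w) 0 i.

(** In the frame, the leading noise coordinates are shifted by [F f] divided by [sigma], a vector on
    the first axis; this is precisely how [chi2nc_rv] encodes noncentrality. *)
Lemma resid_chi2nc sigma w : 0 < sigma ->
  resid (f + sigma *: rvec eps w) =
  sigma * Num.sqrt (chi2nc_rv eta m (resid f / sigma) w).
Proof.
move=> s0; rewrite FE (_ : \sum_(i < n | _) _ =
    sigma ^+ 2 * chi2nc_rv eta m (resid f / sigma) w).
  by rewrite sqrtrM ?sqr_ge0// sqrtr_sqr gtr0_norm.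
rewrite /chi2nc_rv big_distrr /=; apply: eq_bigr => i im.
rewrite -exprMn addrC (giso_lin gF) !mxE Ff//; congr (_ ^+ 2).
by case: ifP => _; rewrite ?addr0// mulrDr mulrC [_ * (_ / _)]mulrC divfK// gt_eqF.
Qed.

Lemma resid_chi2nc0 w :
  resid (rvec eps w) = Num.sqrt (chi2nc_rv eta m 0 w).
Proof.
rewrite FE; congr Num.sqrt; apply: eq_bigr => i _.
by case: ifP; rewrite addr0.
Qed.

End frame.

(** If [q t <= 0], the test rejects whenever the noise has positive inner product with [t], up to a
    null event, hence with probability at least one half. *)
Lemma critical_value_gt0 t : (P (event 0 1) < (2^-1)%:E)%E ->
  t \in Tn -> enorm t = 1 -> 0 < q t.
Proof.
move=> PE tTn t1; rewrite ltNge; apply/negP => qt.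
have [F gF [FV FE Ff]] := residual_frame P 0 Vn.
pose eta (i : 'I_n) w := F (rvec eps w) 0 i.
have geta : gaussian_boxes P eta := giso_law gF geps.
have mE := measurable_Tstat_gt0 Tn q geps Vn 0 1 (\rank V).
have mZ : measurable [set w | eta i0 w = 0].
  by apply: measurable_set_eqr; exact: geta.1.
have mA : measurable [set w | 0 < dotv (rvec eps w) t].
  apply: measurable_set_ltr; first exact: measurable_cst.
  by apply: measurable_dotv_rvec; exact: geps.1.
have mpos : measurable [set x : R | 0 < x].
  by apply: measurable_set_ltr => //; exact: measurable_cst.
have := normal_prob_gt0_half (R := R).
rewrite -(gaussian_dotv n_gt0 geps t1 mpos) leNgt => /negP; apply.
apply: le_lt_trans PE; rewrite -(measureU0 mE mZ); last exact: gaussian_coord_null.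
apply: le_measure; rewrite ?inE//; first exact: measurableU.
move=> w /= Nw; have [z|z] := eqVneq (eta i0 w) 0; first by right.
left; apply/Tstat_gt0P; exists t => //; rewrite scale1r add0r.
apply: le_lt_trans qt _; rewrite divr_gt0 ?mulr_gt0//.
by rewrite (resid_chi2nc0 FE) sqrtr_gt0 chi2nc_gt0// oppr0.
Qed.

(** Since [q t] is positive, rejection bounds the squared residual by a maximum of squared
    numerators. Dropping the nonpositive [dotv f t] only enlarges the event, so [f] survives solely
    as a shift of the first rotated coordinate. *)
Lemma test_level f sigma : 0 < sigma -> (forall t, t \in Tn -> 0 < q t) ->
  (forall t, t \in Tn -> dotv f t <= 0) ->
  (P (event f sigma) <= P (event 0 1))%E.
Proof.
move=> s0 q0 ft.
have [F gF [FV FE Ff]] := residual_frame P f Vn.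
pose eta (i : 'I_n) w := F (rvec eps w) 0 i.
have geta : gaussian_boxes P eta := giso_law gF geps.
pose N t (x : n.-tuple R) := dotv (\row_i tnth x i) (F t).
pose S (x : n.-tuple R) := \sum_(i < n | (i < m)%N && (i != i0)) tnth x i ^+ 2.
(* Truncating the numerator at 0 keeps large negative numerators from passing the squared
   comparison. *)
pose b t x := (sqm * Num.max (N t x) 0 / q t) ^+ 2.
(* [K] does not depend on coordinate [i0], because the directions [F t] do not. *)
pose K x := \big[Num.max/0]_(t <- Tn) b t x - S x.
have mK : measurable_fun setT K.
  apply: measurable_funB; last first.
    rewrite /S; under eq_fun do rewrite big_mkcond.
    apply: measurable_sum => i; case: (_ && _); last exact: measurable_cst.
    by apply: measurable_funX; exact: measurable_tnth.
  elim: (Tn) => [|t s IH].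
    by under eq_fun do rewrite big_nil; exact: measurable_cst.
  under eq_fun do rewrite big_cons.
  apply: measurable_maxr => //; apply: measurable_funX; apply: measurable_funM => //.
  apply: measurable_funM => //; apply: measurable_maxr => //.
  apply: (measurable_dotv_rvec (X := fun i (x : n.-tuple R) => tnth x i)) => i.
  exact: measurable_tnth.
have Kext x x' : (forall j, j != i0 -> tnth x j = tnth x' j) -> K x = K x'.
  move=> xx; rewrite /K; congr (_ - _); last first.
    by apply: eq_bigr => i /andP[_ /xx ->].
  rewrite big_seq [RHS]big_seq; apply: eq_bigr => t tTn; rewrite /b; congr (_ ^+ 2).
  congr (_ * Num.max _ _ / _); apply: eq_bigr => i _; rewrite !mxE.
  have [->|ii0] := eqVneq i i0; last by rewrite xx.
  by rewrite (FV t (TnV tTn) i0 i0m) !mulr0.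
have NE t w : N t [tuple eta i w | i < n] = dotv (rvec eps w) t.
  rewrite -(giso_dot gF); congr dotv; apply/rowP => i.
  by rewrite mxE tnth_mktuple.
have SE w a : chi2nc_rv eta m a w = (eta i0 w + a) ^+ 2 + S [tuple eta i w | i < n].
  rewrite chi2nc_split; congr (_ + _); apply: eq_bigr => i _.
  by rewrite tnth_mktuple.
have mE g s := measurable_Tstat_gt0 Tn q geps Vn g s (\rank V).
pose H a := [set w | (eta i0 w + a) ^+ 2 < K [tuple eta i w | i < n]].
have mH a : measurable (H a).
  apply: measurable_set_ltr.
    by apply: measurable_funX; apply: measurable_funD; [exact: geta.1|exact: measurable_cst].
  by apply: (measurableT_comp mK); apply: measurable_mktuple; exact: geta.1.
have mZ : measurable [set w | eta i0 w = 0].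
  by apply: measurable_set_eqr; exact: geta.1.
have chi_ge0 w a : 0 <= chi2nc_rv eta m a w.
  by apply: sumr_ge0 => i _; exact: sqr_ge0.
have up : event f sigma `<=` H (resid f / sigma).
  move=> w /Tstat_gt0P[t tTn]; set a := resid f / sigma.
  rewrite (resid_chi2nc gF FE Ff)// -/a; set c := chi2nc_rv _ _ _ _ => h.
  have qt := q0 t tTn; have ft0 := ft t tTn.
  (* For [c = 0] the quotient is 0 by convention and cannot exceed the positive [q t]. *)
  have c0 : 0 < c.
    rewrite lt_neqAle chi_ge0 andbT; apply/eqP => c0.
    by move: h; rewrite -c0 sqrtr0 mulr0 invr0 mulr0 ltNge (ltW qt).
  have sc0 : 0 < Num.sqrt c by rewrite sqrtr_gt0.
  rewrite ltr_pdivlMr ?mulr_gt0// in h.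
  have {}h : q t * Num.sqrt c < sqm * dotv (rvec eps w) t.
    rewrite -(ltr_pM2r s0) -mulrA [_ * sigma]mulrC (lt_le_trans h)// -mulrA.
    rewrite ler_pM2l// addrC dotv_linl [_ * sigma]mulrC.
    by rewrite -lerBrDl subrr.
  rewrite /H /= ltrBrDr -SE -/c.
  apply: (@lt_le_trans _ _ (b t [tuple eta i w | i < n])); last first.
    exact: (le_bigmax_seq 0 t xpredT (b^~ [tuple eta i w | i < n]) tTn isT).
  have N0 : 0 < dotv (rvec eps w) t.
    by rewrite -(pmulr_rgt0 _ sqm_gt0) (lt_trans _ h)// mulr_gt0.
  rewrite /b NE max_l ?(ltW N0)// -[ltLHS]sqr_sqrtr ?(ltW c0)//.
  have d0 : 0 <= sqm * dotv (rvec eps w) t / q t.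
    by rewrite divr_ge0 ?mulr_ge0 ?(ltW qt) ?(ltW N0) ?(ltW sqm_gt0).
  by rewrite ltr_pXn2r ?nnegrE ?sqrtr_ge0// ltr_pdivlMr// mulrC.
(* For zero mean the inclusion is reversed, except where the residual may vanish. *)
have low : H 0 `<=` event 0 1 `|` [set w | eta i0 w = 0].
  move=> w; rewrite /H /= ltrBrDr -SE => h.
  have [z|z] := eqVneq (eta i0 w) 0; [by right|left].
  have [t tTn {}h] := lt_bigmax_ge0 (chi_ge0 w 0) h.
  apply/Tstat_gt0P; exists t => //; rewrite scale1r add0r.
  have c0 : 0 < chi2nc_rv eta m 0 w by rewrite chi2nc_gt0// oppr0.
  rewrite (resid_chi2nc0 FE) -/eta.
  have N0 : 0 < dotv (rvec eps w) t.
    rewrite ltNge; apply/negP => N0; move: h.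
    by rewrite /b NE max_r// mulr0 mul0r expr0n ltNge ltW.
  move: h; rewrite /b NE max_l ?(ltW N0)// => h.
  rewrite ltr_pdivlMr ?sqrtr_gt0// mulrC -ltr_pdivlMr ?q0//.
  rewrite -(@ltr_pXn2r _ 2)// ?nnegrE ?sqrtr_ge0 ?sqr_sqrtr ?(ltW c0)//.
  by rewrite divr_ge0 ?mulr_ge0 ?(ltW (q0 t tTn)) ?ltW.
apply: (@le_trans _ _ (P (H (resid f / sigma)))).
  by apply: le_measure; rewrite ?inE.
apply: (@le_trans _ _ (P (H 0))).
  apply: le_trans (gaussian_shifted_square_le geta (resid f / sigma) mK Kext) _.
  by rewrite /H; under [X in (_ <= P X)%E]eq_set do rewrite addr0.
rewrite -(measureU0 (mE 0 1) mZ); last exact: gaussian_coord_null.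
by apply: le_measure; rewrite ?inE//; exact: measurableU.
Qed.

(** Off [A1] and [A2], each of probability at most [beta / 2], and the null event [Z], the residual
    is at most [sigma * Num.sqrt Q] and the noise in direction [t] exceeds [- z]; the assumed bound
    on [dotv f t] then forces rejection. *)
Lemma test_power f sigma beta t : 0 < sigma -> 0 < beta < 1 ->
  t \in Tn -> enorm t = 1 -> 0 < q t ->
  (q t * sqm^-1 * Num.sqrt (upper_quantile P
     (chi2nc_rv eps m (resid f / sigma)) (beta / 2))
   + gauss_upper_quantile (beta / 2)) * sigma <= dotv f t ->
  ((1 - beta)%:E <= P (event f sigma))%E.
Proof.
move=> s0 beta01 tTn t1 qt hf.
have [F gF [FV FE Ff]] := residual_frame P f Vn.
pose eta (i : 'I_n) w := F (rvec eps w) 0 i.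
have geta : gaussian_boxes P eta := giso_law gF geps.
set a := resid f / sigma in hf; set z := gauss_upper_quantile _ in hf.
set Q := upper_quantile _ _ _ in hf.
have u01 : 0 < beta / 2 < 1 by move: beta01; lra.
have mchi (X : 'I_n -> T -> R) : (forall i, measurable_fun setT (X i)) ->
    measurable_fun setT (chi2nc_rv X m a).
  move=> mX; rewrite /chi2nc_rv; under eq_fun do rewrite big_mkcond.
  apply: measurable_sum => i; case: (i < _)%N; last exact: measurable_cst.
  by apply: measurable_funX; apply: measurable_funD => //; exact: measurable_cst.
pose A1 := [set w | Q < chi2nc_rv eta m a w].
pose A2 := [set w | dotv (rvec eps w) t <= - z].
pose Z := [set w | eta i0 w = - a].
have mA1 : measurable A1.
  apply: measurable_set_ltr; first exact: measurable_cst.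
  by apply: mchi; exact: geta.1.
have mz : measurable [set x : R | x <= - z].
  rewrite (_ : [set _ | _] = `]-oo, (- z)]%classic).
    exact: measurable_itv.
  by apply/seteqP; split => x; rewrite /= in_itv.
have mA2 : measurable A2.
  rewrite -[X in measurable X]setTI.
  exact: (measurable_dotv_rvec t geps.1 measurableT mz).
have mZ : measurable Z by apply: measurable_set_eqr; exact: geta.1.
(* The quantile [Q] refers to [eps] while [A1] involves the rotated noise [eta]; equality of their
   laws transfers the bound. *)
have PA1 : (P A1 <= (beta / 2)%:E)%E.
  pose B : set (n.-tuple R) := [set x | Q <
    \sum_(i < n | (i < m)%N) (tnth x i + (if val i == 0%N then a else 0)) ^+ 2].
  have mB : measurable B.
    apply: measurable_set_ltr; first exact: measurable_cst.
    under eq_fun do rewrite big_mkcond.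
    apply: measurable_sum => i; case: (i < _)%N; last exact: measurable_cst.
    apply: measurable_funX; apply: measurable_funD; last exact: measurable_cst.
    exact: measurable_tnth.
  have BE (X : 'I_n -> T -> R) : [set w | Q < chi2nc_rv X m a w] =
      [set w | B [tuple X i w | i < n]].
    have e w : chi2nc_rv X m a w = \sum_(i < n | (i < m)%N)
        (tnth [tuple X i w | i < n] i + (if val i == 0%N then a else 0)) ^+ 2.
      by apply: eq_bigr => i _; rewrite tnth_mktuple.
    by apply/seteqP; split => w; rewrite /B /= e.
  rewrite /A1 BE (gaussian_law_unique geta geps mB) -BE.
  by apply: upper_quantile_le => //; apply: mchi; exact: geps.1.
have PA2 : (P A2 <= (beta / 2)%:E)%E.
  rewrite /A2 (gaussian_dotv n_gt0 geps t1 mz).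
  exact: normal_prob_le_opp_quantile.
have mE := measurable_Tstat_gt0 Tn q geps Vn f sigma (\rank V).
have mU : measurable (A1 `|` A2 `|` Z).
  by apply: measurableU => //; exact: measurableU.
apply: (@le_trans _ _ (P (~` (A1 `|` A2 `|` Z)))).
  rewrite probability_setC// EFinB; apply: leeB => //.
  rewrite measureU0//; [|exact: measurableU|exact: gaussian_coord_null].
  apply: le_trans (measureU2 P mA1 mA2) _.
  by apply: le_trans (leeD PA1 PA2) _; rewrite -EFinD lee_fin; lra.
apply: le_measure; rewrite ?inE//; first exact: measurableC.
move=> w /= h.
have zw : eta i0 w != - a by apply/eqP => zw; apply: h; right.
have cQ : chi2nc_rv eta m a w <= Q.
  by rewrite leNgt; apply/negP => ?; apply: h; left; left.
have Nz : - z < dotv (rvec eps w) t.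
  by rewrite ltNge; apply/negP => ?; apply: h; left; right.
apply/Tstat_gt0P; exists t => //.
rewrite (resid_chi2nc gF FE Ff)// -/a -/eta.
set c := chi2nc_rv _ _ _ _ in cQ *.
have c0 : 0 < Num.sqrt c by rewrite sqrtr_gt0 chi2nc_gt0.
rewrite ltr_pdivlMr ?mulr_gt0//.
have sQ : Num.sqrt c <= Num.sqrt Q by rewrite ler_wsqrtr.
have e : q t = sqm * (q t * sqm^-1) by rewrite mulrCA divff ?mulr1// gt_eqF.
rewrite {1}e -mulrA ltr_pM2l// addrC dotv_linl.
set r := q t * _ in hf *.
have r0 : 0 < r by rewrite mulr_gt0// invr_gt0.
apply: (@le_lt_trans _ _ (r * Num.sqrt Q * sigma)).
  by rewrite [sigma * _]mulrC mulrA ler_pM2r// ler_pM2l.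
have : - z * sigma < dotv (rvec eps w) t * sigma by rewrite ltr_pM2r.
by move: hf; rewrite mulrDl [sigma * _]mulrC; lra.
Qed.

End test_level_power.

Theorem theorem1 (R : realType) (n : nat) (dT : measure_display)
  (T : measurableType dT) (P : probability T R) (eps : 'I_n -> T -> R)
  (alpha : R) (p : nat) (v : 'I_p -> 'rV[R]_n) (Tn : seq 'rV[R]_n)
  (d : nat) (V : 'M[R]_n) (q : 'rV[R]_n -> R) :
  (2 <= n)%N ->
  std_gaussian_vector P eps ->
  0 < alpha < 1 / 2 ->
  row_free (\matrix_(j < p) v j) ->
  {subset Tn <= setT_dir v} ->
  \rank V = d -> (d < n)%N ->
  (forall t, t \in Tn -> (t <= V)%MS) ->
  P [set w | (0 < Tstat d V Tn q (rvec eps w))%E] = alpha%:E ->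
  let PT (f : 'rV[R]_n) (sigma : R) :=
    P [set w | (0 < Tstat d V Tn q (f + sigma *: rvec eps w))%E] in
  (ereal_sup [set PT f sigma | f in coneC v & sigma in [set s : R | 0 < s]]
     = PT 0 1 /\ PT 0 1 = alpha%:E) /\
  (forall (beta : R) (f : 'rV[R]_n) (sigma : R),
     0 < beta < 1 -> 0 < sigma ->
     (exists2 t, t \in Tn &
        dotv f t >=
        (q t * (Num.sqrt (n - d)%:R)^-1 *
           Num.sqrt (upper_quantile P
              (chi2nc_rv eps (n - d) (enorm (f - orth_proj V f) / sigma))
              (beta / 2))
         + gauss_upper_quantile (beta / 2)) * sigma) ->
     (PT f sigma >= (1 - beta)%:E)%E).
Proof.
move=> n2 sg alpha01 _ TnT rV dn TnV PT0 PT; move: dn PT0 @PT.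
rewrite -{}rV {d} => Vn PT0 PT.
have geps : gaussian_boxes P eps := iffLR (std_gaussian_boxesP P eps) sg.
have dir t : t \in Tn -> setT_dir v t by move=> /TnT; rewrite inE.
have PT01 : PT 0 1 = alpha%:E.
  apply: etrans PT0; congr (P _).
  by apply/seteqP; split => w /=; rewrite scale1r add0r.
have q0 t : t \in Tn -> 0 < q t.
  move=> tTn; apply: (critical_value_gt0 geps Vn _ tTn (dir t tTn).1).
  (* Positivity of the critical values is where [alpha < 1 / 2] enters. *)
  by rewrite -/(PT 0 1) PT01 lte_fin; move: alpha01; lra.
split; last first.
  move=> beta f sigma b01 s0 [t tTn hf].
  exact: (test_power geps Vn s0 b01 tTn (dir t tTn).1 (q0 t tTn) hf).
split=> //; apply/eqP; rewrite eq_le; apply/andP; split.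
  apply: ge_ereal_sup => _ [f fC [sigma /= s0 <-]].
  apply: (test_level geps Vn TnV s0 q0) => t tTn.
  have [_ [lam [lam0 ->]]] := dir t tTn.
  (* Directions are nonnegative combinations of the [v j], so the cone inequalities extend to
     them. *)
  rewrite dotvC; elim/big_ind: _ => [|x y x0 y0|j _].
  - by rewrite /dotv big1// => i _; rewrite mxE mul0r.
  - by rewrite dotvDl -[leRHS]addr0 lerD.
  by rewrite dotvZl dotvC mulr_ge0_le0// fC.
(* The supremum is attained at the apex of the cone with unit variance. *)
apply: ereal_sup_ubound; exists 0; last by exists 1 => //=; exact: ltr01.
by move=> j; rewrite /dotv big1// => i _; rewrite mxE mul0r.
Qed.
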